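(* Let $n\ge 2$ be an integer and let $\alpha\in[0,180^\circ]$. Then $C(n,\alpha)\le n-1$.
   Context: A set $A\subset\mathbb{R}^n$ contains the angle $\alpha\in[0,180^\circ]$ if there exist distinct points $x,y,z\in A$ such that the angle between the vectors $y-x$ and $z-x$ is $\alpha$. Let $\dim$ denote Hausdorff dimension. For an integer $n\ge2$ and $\alpha\in[0,180^\circ]$ define $$C(n,\alpha)=\sup\{s : \text{there is a compact } A\subset\mathbb{R}^n \text{ with } \dim(A)=s \text{ such that } A \text{ does not contain the angle } \alpha\}.$$ *)

(* Defs.v *)
From mathcomp Require Import all_boot all_order all_algebra.
From mathcomp Require Import all_classical all_reals all_analysis.

Set Implicit Arguments.
Unset Strict Implicit.
Unset Printing Implicit Defensive.

Import Order.TTheory GRing.Theory Num.Theory.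
Import numFieldNormedType.Exports.

Local Open Scope classical_set_scope.
Local Open Scope ring_scope.

(* The library's norm on 'rV[R]_n is the sup norm; angles and diameters need
   the Euclidean one.  Both induce the library's topology on 'rV[R]_n, so
   [compact] is used as it stands. *)

Definition edot (R : realType) (n : nat) (u v : 'rV[R]_n) : R :=
  \sum_(i < n) u 0 i * v 0 i.

Definition enorm (R : realType) (n : nat) (u : 'rV[R]_n) : R :=
  Num.sqrt (edot u u).

(* In radians; meaningful for u, v != 0. *)
Definition angle (R : realType) (n : nat) (u v : 'rV[R]_n) : R :=
  acos (edot u v / (enorm u * enorm v)).

Definition contains_angle (R : realType) (n : nat) (A : set 'rV[R]_n)
    (alpha : R) : Prop :=
  exists x y z : 'rV[R]_n,
    [/\ A x, A y & A z] /\ [/\ x != y, x != z & y != z] /\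
    angle (y - x) (z - x) = alpha.

Local Open Scope ereal_scope.

(* [maxe 0] makes the diameter of the empty set 0 instead of -oo. *)
Definition ediam (R : realType) (n : nat) (U : set 'rV[R]_n) : \bar R :=
  maxe 0 (ereal_sup [set (enorm (p.1 - p.2))%:E | p in U `*` U]).

(* Since 0 `^ 0 = 1, the empty set is treated apart so that it contributes
   nothing to a cover even when s = 0. *)
Definition ediam_pow (R : realType) (n : nat) (s : R) (U : set 'rV[R]_n)
    : \bar R :=
  if U == set0 then 0 else ediam U `^ s.

(* Finite covers are covers by sequences that are eventually set0. *)
Definition delta_cover (R : realType) (n : nat) (delta : R)
    (A : set 'rV[R]_n) (U : nat -> set 'rV[R]_n) : Prop :=
  A `<=` \bigcup_i U i /\ forall i, ediam (U i) <= delta%:E.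

Definition hausdorff_premeasure (R : realType) (n : nat) (s delta : R)
    (A : set 'rV[R]_n) : \bar R :=
  ereal_inf [set \sum_(0 <= i <oo) ediam_pow s (U i) | U in delta_cover delta A].

Definition hausdorff_measure (R : realType) (n : nat) (s : R)
    (A : set 'rV[R]_n) : \bar R :=
  ereal_sup [set hausdorff_premeasure s delta A
            | delta in [set delta : R | (0 < delta)%R]].

Definition hausdorff_dim (R : realType) (n : nat) (A : set 'rV[R]_n)
    : \bar R :=
  ereal_inf [set s%:E | s in [set s : R | (0 <= s)%R /\
                                          hausdorff_measure s A = 0]].

Definition C (R : realType) (n : nat) (alpha : R) : \bar R :=
  ereal_sup [set s | exists A : set 'rV[R]_n,
    [/\ compact A, hausdorff_dim A = s & ~ contains_angle A alpha]].

(* Main.v *)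
(** Let [A] be compact in dimension [n = d + 1], avoid the angle [alpha], and let
    [q < 2^-d]; the claim is that [A] has finite dyadic covers with arbitrarily
    small [sum q^level], so that [H^s(A) = 0] for [s > d].  If [alpha = 0] is
    avoided, no three points of [A] are collinear, so [pi] is avoided too and we
    may assume [alpha > 0].

    Fix [r = 2^-p].  By compactness there is a scale [2^-m] such that for unit
    vectors [th, ph] at angle [alpha], no point [x] of [A] sees points of [A] at
    distance at least [r] both in direction [th] and in direction [ph], up to an
    error [2^-m].  Put a discrete Frostman weight [mu] on a [2^-m]-net: level-[k]
    cells have mass at most [q^k], and the total mass [W] is the [q]-sum of some
    dyadic cover.  For every pair [(th, ph)] the points that see nothing in
    direction [th], or those that see nothing in direction [ph], have mass at
    least [W / 2]; call this set [B].  By Cauchy-Schwarz over about [2^(m d)]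
    tubes, [mu x mu] gives mass at least about [W^2 2^(-m d)] to the pairs in [B]
    in a common tube, and such pairs are at distance at most [r] since otherwise
    one sees the other.  Averaging over the pairs [(R_u a, R_u b)], where [a, b]
    is a fixed pair and [R_u] is the reflection with normal [u] running over a
    grid, bounds [W] by the [d]-energy of [mu] at distances at most [r], which is
    at most a constant times [(q 2^d)^p]. *)

Require Import Defs.
From mathcomp Require Import all_boot all_order all_algebra.
From mathcomp Require Import all_classical all_reals all_analysis.
From mathcomp Require Import ring lra zify.

Set Implicit Arguments.
Unset Strict Implicit.
Unset Printing Implicit Defensive.

Import Order.TTheory GRing.Theory Num.Theory.
Import numFieldNormedType.Exports.

Local Open Scope ring_scope.

(** * Frostman weights on finite trees *)

(** Discrete Frostman construction, from the finest level to the coarsest: spread mass [q ^+ m]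
    evenly over each level-[m] class, then at each coarser level scale every class that is too heavy
    down to its allowed mass. A rescaled class becomes saturated; in a class left alone, the
    saturated subclasses found before survive. *)
Lemma saturated_weights (R : realFieldType) (X : finType) (e : nat -> rel X)
    (q : R) (m : nat) :
  0 < q -> (forall k, equivalence_rel (e k)) ->
  (forall k x y, e k.+1 x y -> e k x y) ->
  exists mu : X -> R,
    [/\ forall x, 0 <= mu x,
        forall k x, (k <= m)%N -> \sum_(y | e k x y) mu y <= q ^+ k &
        forall x, exists2 k, (k <= m)%N & \sum_(y | e k x y) mu y = q ^+ k].
Proof.
move=> q_gt0 eqv nest.
have eR k x : e k x x by have [] := eqv k x x x.
have eL k x y z : e k x y -> e k x z = e k y z by have [_] := eqv k x y z; apply.
have eS k x y : e k x y -> e k y x by move=> /eL <-.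
have nestD k j x y : e (j + k)%N x y -> e k x y.
  by elim: j => // j IH; rewrite addSn => /nest.
suff H j : (j <= m)%N -> exists mu : X -> R,
    [/\ forall x, 0 <= mu x,
        forall k x, (m - j <= k <= m)%N -> \sum_(y | e k x y) mu y <= q ^+ k &
        forall x, exists2 k, (m - j <= k <= m)%N &
          \sum_(y | e k x y) mu y = q ^+ k].
  have [mu [mu0 muL muS]] := H m (leqnn m); exists mu; split=> // [k x km|x].
    by apply: muL; rewrite subnn.
  by have [k] := muS x; rewrite subnn; exists k.
elim: j => [_|j IH jm].
  pose N x := #|[pred y | e m x y]|.
  have N0 x : (0 < N x)%N by apply/card_gt0P; exists x; rewrite inE.
  have sumN x : \sum_(y | e m x y) (q ^+ m / (N y)%:R) = q ^+ m.
    transitivity (\sum_(y | e m x y) (q ^+ m / (N x)%:R)).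
      apply: eq_bigr => y exy; congr (_ / _%:R).
      by apply: eq_card => z; rewrite !inE (eL _ _ _ _ exy).
    rewrite sumr_const -[_ *+ _]mulr_natr.
    have ->: #|(fun y => e m x y)| = N x by [].
    by rewrite mulfVK // pnatr_eq0 -lt0n.
  exists (fun x => q ^+ m / (N x)%:R); split=> [x|k x|x].
  - by rewrite divr_ge0 ?ler0n// exprn_ge0// ltW.
  - by rewrite subn0 -eqn_leq => /eqP <-; rewrite sumN.
  - by exists m; rewrite ?subn0 ?leqnn.
have [mu [mu0 muL muS]] := IH (ltnW jm).
set l := (m - j.+1)%N; have lm : (m - j = l.+1)%N by rewrite /l; lia.
pose S x := \sum_(y | e l x y) mu y.
(* This factor is constant on level-[l] classes and at most 1, so bounds at finer levels persist. *)
pose f x := if S x <= q ^+ l then 1 else q ^+ l / S x.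
have eS_S x y : e l x y -> S x = S y.
  by move=> exy; apply: eq_bigl => z; rewrite (eL _ _ _ _ exy).
have f_e x y : e l x y -> f x = f y by move=> /eS_S; rewrite /f => ->.
have S0 x : 0 <= S x by apply: sumr_ge0.
have f0 x : 0 <= f x.
  by rewrite /f; case: ifP => // _; rewrite divr_ge0// exprn_ge0// ltW.
have f1 x : f x <= 1.
  rewrite /f; case: (leP (S x)) => // h.
  by rewrite ler_pdivrMr ?mul1r ?ltW//; apply: lt_trans h; rewrite exprn_gt0.
have sumf k x : (l <= k)%N ->
    \sum_(y | e k x y) f y * mu y = f x * \sum_(y | e k x y) mu y.
  move=> lk; rewrite mulr_sumr; apply: eq_bigr => y exy.
  by rewrite (@f_e x y)//; apply: (nestD _ (k - l)%N); rewrite subnK.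
exists (fun x => f x * mu x); split=> [x|k x /andP[lk km]|x].
- exact: mulr_ge0.
- rewrite sumf //; have [kl|kl] := eqVneq k l.
    rewrite kl -/(S x) /f; case: (leP (S x)) => [h|h]; first by rewrite mul1r.
    by rewrite mulfVK// gt_eqF//; apply: lt_trans h; rewrite exprn_gt0.
  apply: le_trans (muL k x _); last by rewrite km lm andbT ltn_neqAle eq_sym kl.
  by rewrite ler_piMl// sumr_ge0.
- have [h|h] := leP (S x) (q ^+ l).
    have [k kj Sk] := muS x; exists k; first by apply/andP; split; lia.
    by rewrite sumf ?Sk /f ?h ?mul1r//; lia.
  exists l; first by apply/andP; split; lia.
  rewrite sumf// -/(S x) /f leNgt h/= mulfVK// gt_eqF//.
  by apply: lt_trans h; rewrite exprn_gt0.
Qed.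

(** The coarsest saturated class around each point, at level [kap x], has mass exactly [q ^+ kap x].
    These classes partition [X], so listing each once gives a cover whose [q]-sum is the total
    mass. *)
Lemma weights_and_cover (R : realFieldType) (X : finType) (e : nat -> rel X)
    (q : R) (m : nat) :
  0 < q -> (forall k, equivalence_rel (e k)) ->
  (forall k x y, e k.+1 x y -> e k x y) ->
  exists (mu : X -> R) (s : seq (X * nat)),
    [/\ forall x, 0 <= mu x,
        forall k x, (k <= m)%N -> \sum_(y | e k x y) mu y <= q ^+ k,
        forall x, exists2 c, c \in s & (c.2 <= m)%N && e c.2 c.1 x &
        \sum_(c <- s) q ^+ c.2 = \sum_x mu x].
Proof.
move=> q_gt0 eqv nest.
have [mu [mu0 muL muS]] := saturated_weights m q_gt0 eqv nest.
have eR k x : e k x x by have [] := eqv k x x x.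
have eL k x y z : e k x y -> e k x z = e k y z by have [_] := eqv k x y z; apply.
have eS k x y : e k x y -> e k y x by move=> /eL <-.
have nestD k j x y : (k <= j)%N -> e j x y -> e k x y.
  move=> /subnK <-; elim: (j - k)%N => // i IH; rewrite addSn => /nest.
  exact: IH.
have sat x : exists k, \sum_(y | e k x y) mu y == q ^+ k.
  by have [k _ /eqP] := muS x; exists k.
pose kap x := ex_minn (sat x).
have kapE x : \sum_(y | e (kap x) x y) mu y = q ^+ kap x.
  by rewrite /kap; case: ex_minnP => k /eqP.
have kap_min x k : \sum_(y | e k x y) mu y = q ^+ k -> (kap x <= k)%N.
  by rewrite /kap; case: ex_minnP => j _ h /eqP /h.
have kap_le x : (kap x <= m)%N.
  by have [k km /kap_min kx] := muS x; apply: leq_trans kx km.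
have sum_e k x y : e k x y -> \sum_(z | e k x z) mu z = \sum_(z | e k y z) mu z.
  by move=> exy; apply: eq_bigl => z; rewrite (eL _ _ _ _ exy).
(* Two smallest saturated classes are equal or disjoint. *)
have kap_e x y : e (kap x) x y -> kap x = kap y.
  move=> exy; have yx : (kap y <= kap x)%N.
    by apply: kap_min; rewrite -(sum_e _ _ _ exy).
  apply/eqP; rewrite eqn_leq yx andbT; apply: kap_min.
  by rewrite (sum_e _ _ _ (nestD _ _ _ _ yx exy)).
pose E x y := e (kap x) x y.
have EL x y z : E x y -> E x z = E y z.
  by move=> exy; rewrite /E -(kap_e _ _ exy) (eL _ _ _ _ exy).
have ES x y : E x y -> E y x by move=> /EL <-; apply: eR.
(* A representative that depends only on the predicate [E x], hence only on the class. *)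
pose h x := odflt x [pick y | E x y].
have Eh x : E x (h x) by rewrite /h; case: pickP => //= _; apply: eR.
have hE x y : E x y -> h x = h y.
  move=> exy; rewrite /h; have Exy : E x =1 E y by move=> z; apply: EL.
  rewrite (eq_pick Exy); case: pickP => //= /(_ y); rewrite /E eR //.
have hEb x y : (h x == h y) = E x y.
  apply/eqP/idP => [hxy|]; last exact: hE.
  by rewrite (EL _ _ _ (Eh x)) hxy -(EL _ _ _ (Eh y)); apply: eR.
pose T := [set h x | x in X].
exists mu, [seq (x, kap x) | x <- enum T]; split=> // [x|].
  exists (h x, kap (h x)); last by rewrite /= kap_le; apply: ES.
  by apply/mapP; exists (h x) => //; rewrite mem_enum; apply/imsetP; exists x.
rewrite big_map big_enum /=.
rewrite [RHS](partition_big h (mem T))/=; last by move=> x _; apply/imsetP; exists x.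
apply: eq_bigr => _ /imsetP[x _ ->]; rewrite -kapE; apply: eq_bigl => y.
by rewrite hEb -/(E _ _) -(EL _ _ _ (Eh x)); apply/idP/idP; apply: ES.
Qed.

(** * Counting and Cauchy-Schwarz *)

(** Integers at distance at most [L] that agree modulo [L.+1] are equal. Hence [g] is determined on
    [S] by its sign, its coordinate [0] and the residues of the other [d] coordinates. *)
Lemma card_grid_cluster (d N L : nat) (S : {set {ffun 'I_d.+1 -> 'I_N}})
    (sg : {ffun 'I_d.+1 -> 'I_N} -> bool) :
  {in S &, forall g h, sg g = sg h -> g ord0 = h ord0 ->
     forall j, (g j <= h j + L)%N} ->
  (#|S| <= 2 * N * L.+1 ^ d)%N.
Proof.
move=> clu.
pose f (g : {ffun 'I_d.+1 -> 'I_N}) : bool * 'I_N * {ffun 'I_d -> 'I_L.+1} :=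
  (sg g, g ord0, [ffun j => inord (g (lift ord0 j) %% L.+1)]).
have f_inj : {in S &, injective f}.
  move=> g h gS hS [sgE g0E /ffunP fE]; apply/ffunP => i.
  have [j ->|->//] := unliftP ord0 i; apply: val_inj => /=.
  have := congr1 (@nat_of_ord _) (fE j); rewrite !ffunE !inordK ?ltn_mod// => modE.
  have h1 := clu g h gS hS sgE g0E (lift ord0 j).
  have h2 := clu h g hS gS (esym sgE) (esym g0E) (lift ord0 j).
  set a := nat_of_ord (g _) in modE h1 h2 *.
  set b := nat_of_ord (h _) in modE h1 h2 *.
  wlog ab : a b modE h1 h2 / (a <= b)%N.
    by move=> W; have [ab|/ltnW ab] := leqP a b; [|symmetry]; apply: W.
  have : (L.+1 %| b - a)%N by rewrite -eqn_mod_dvd// modE.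
  case: (posnP (b - a)) => [|ba0 /dvdn_leq]; first by lia.
  by move=> /(_ ba0); lia.
rewrite -(card_in_imset f_inj).
apply: leq_trans (max_card _) _.
by rewrite !card_prod card_bool card_ffun !card_ord.
Qed.

Lemma sqr_sum_le (R : realFieldType) (T : finType) (s : T -> R) :
  (\sum_t s t) ^+ 2 <= #|T|%:R * \sum_t s t ^+ 2.
Proof.
have h : 0 <= \sum_t \sum_u (s t - s u) ^+ 2.
  by apply: sumr_ge0 => t _; apply: sumr_ge0 => u _; apply: sqr_ge0.
have hE : \sum_t \sum_u (s t - s u) ^+ 2 =
    (#|T|%:R * \sum_t s t ^+ 2 - (\sum_t s t) ^+ 2) *+ 2.
  transitivity (\sum_t (#|T|%:R * s t ^+ 2 + (\sum_u s u ^+ 2)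
                        - (\sum_u s u) * s t *+ 2)).
    apply: eq_bigr => t _.
    transitivity (\sum_u (s t ^+ 2 + s u ^+ 2 - s u * s t *+ 2)).
      by apply: eq_bigr => u _; ring.
    rewrite big_split big_split /= sumr_const sumrN sumrMnl -mulr_suml.
    by rewrite mulr_natl.
  rewrite big_split big_split /= sumr_const sumrN sumrMnl -mulr_sumr -mulr_sumr.
  by rewrite -[X in _ + X - _]mulr_natl; ring.
by move: h; rewrite hE pmulrn_lge0// subr_ge0.
Qed.

(** The square of a bucket's mass is the product mass of the pairs inside it. *)
Lemma bucket_cauchy_schwarz (R : realFieldType) (X T : finType) (mu : X -> R)
    (b : X -> T) (B : pred X) :
  (\sum_(x | B x) mu x) ^+ 2 <=
    #|T|%:R * \sum_(x | B x) \sum_(y | B y && (b x == b y)) mu x * mu y.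
Proof.
have -> : \sum_(x | B x) mu x = \sum_t \sum_(x | B x && (b x == t)) mu x.
  exact: partition_big.
apply: le_trans (sqr_sum_le _) _; rewrite ler_wpM2l// [leRHS](partition_big b predT)//=.
apply: ler_sum => t _; rewrite expr2 mulr_suml; apply: ler_sum => x /andP[_ /eqP <-].
rewrite mulr_sumr le_eqVlt; apply/orP; left; apply/eqP; apply: eq_bigl => y.
by rewrite [b y == _]eq_sym.
Qed.

(** * Dyadic cells and discrete energy *)

Lemma rV_norm_leP (R : realType) (n : nat) (v : 'rV[R]_n) (c : R) :
  0 <= c -> reflect (forall i, `|v 0 i| <= c) (`|v| <= c).
Proof.
move=> c0; apply: (iffP idP) => [vc i|vc].
  apply: le_trans vc; rewrite /Num.norm/= mx_normrE.
  exact: (@le_bigmax _ _ _ _ (fun ij : 'I_1 * 'I_n => `|v ij.1 ij.2|) (0, i)).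
rewrite /Num.norm/= mx_normrE; apply: bigmax_le => // -[i j] _ /=.
by rewrite ord1.
Qed.

Lemma rV_coord_le_norm (R : realType) (n : nat) (v : 'rV[R]_n) i :
  `|v 0 i| <= `|v|.
Proof. exact: (elimT (rV_norm_leP _ (normr_ge0 v)) (lexx _) i). Qed.

Definition cell (R : realType) (n k : nat) (x y : 'rV[R]_n) : bool :=
  [forall i, Num.floor (2 ^+ k * x 0 i) == Num.floor (2 ^+ k * y 0 i)].

Lemma cellP (R : realType) (n k : nat) (x y : 'rV[R]_n) :
  reflect (forall i, Num.floor (2 ^+ k * x 0 i) = Num.floor (2 ^+ k * y 0 i))
          (cell k x y).
Proof. exact: 'forall_eqP. Qed.

Lemma cell_equiv (R : realType) (n k : nat) :
  equivalence_rel (@cell R n k).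
Proof.
move=> x y z; split; first exact/cellP.
by move=> /cellP xy; apply/cellP/cellP => + i => /(_ i); rewrite xy.
Qed.

Lemma cell_nested (R : realType) (n k : nat) (x y : 'rV[R]_n) :
  cell k.+1 x y -> cell k x y.
Proof.
move=> /cellP xy; apply/cellP => i; move: (xy i).
rewrite exprS -!mulrA; set a := 2 ^+ k * x 0 i; set b := 2 ^+ k * y 0 i => ab.
apply/esym/floor_def.
have /andP[a1 a2] := floor_itv (2 * a); have /andP[b1 b2] := floor_itv (2 * b).
have /andP[c1 c2] := floor_itv a.
rewrite ab in a1 a2.
set K := Num.floor a in c1 c2 *; set F := Num.floor (2 * b) in a1 a2 b1 b2.
have h1 : (2 * K < F + 1)%R.
  by rewrite -(ltr_int R); move: a1 a2 b1 b2 c1 c2; rewrite !rmorphD/= !rmorphM/=; lra.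
have h2 : (F < 2 * K + 2)%R.
  by rewrite -(ltr_int R); move: a1 a2 b1 b2 c1 c2; rewrite !rmorphD/= !rmorphM/=; lra.
have h3 : (2 * K <= F)%R by lia.
have h4 : (F + 1 <= 2 * K + 2)%R by lia.
move: h3 h4 b1 b2; rewrite -(ler_int R) -(ler_int R (F + 1)).
rewrite !rmorphD/= !rmorphM/= => *; apply/andP; split; lra.
Qed.

Lemma cell_dist (R : realType) (n k : nat) (x y : 'rV[R]_n) :
  cell k x y -> `|x - y| <= 2 ^- k.
Proof.
have k0 : 0 < 2 ^+ k :> R by rewrite exprn_gt0.
move=> /cellP xy; apply/rV_norm_leP => [|i]; first by rewrite invr_ge0 ltW.
rewrite !mxE -(ler_pM2l k0) mulfV ?gt_eqF// -{1}(gtr0_norm k0) -normrM mulrBr.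
have := floor_itv (2 ^+ k * x 0 i); rewrite xy.
have := floor_itv (2 ^+ k * y 0 i); rewrite rmorphD/=.
by rewrite ler_norml => /andP[? ?] /andP[? ?]; apply/andP; split; lra.
Qed.

(** In each coordinate the floors of two points at distance at most [2 ^- k] differ by at most 1, so
    the ball meets at most [3 ^ n] cells. *)
Lemma ball_mass (R : realType) (n k : nat) (X : finType) (f : X -> 'rV[R]_n)
    (mu : X -> R) (c : R) (x : X) :
  0 <= c -> (forall y, 0 <= mu y) ->
  (forall y, \sum_(z | cell k (f y) (f z)) mu z <= c) ->
  \sum_(y | `|f x - f y| <= 2 ^- k) mu y <= (3 ^ n)%:R * c.
Proof.
move=> c0 mu0 muc.
have k0 : 0 < 2 ^+ k :> R by rewrite exprn_gt0.
pose fl y i := Num.floor (2 ^+ k * f y 0 i).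
have fl_near y i : `|f x - f y| <= 2 ^- k ->
    (fl x i <= fl y i + 1) /\ (fl y i <= fl x i + 1).
  move=> xy; have := le_trans (rV_coord_le_norm (f x - f y) i) xy.
  rewrite !mxE -(ler_pM2l k0) mulfV ?gt_eqF// -{1}(gtr0_norm k0) -normrM mulrBr.
  have /andP[] := floor_itv (2 ^+ k * f x 0 i).
  have /andP[] := floor_itv (2 ^+ k * f y 0 i).
  rewrite -/(fl x i) -/(fl y i) !rmorphD/= ler_norml => y1 y2 x1 x2 /andP[h1 h2].
  have h3 : (fl x i < fl y i + 2) by rewrite -(ltr_int R) rmorphD/=; lra.
  have h4 : (fl y i < fl x i + 2) by rewrite -(ltr_int R) rmorphD/=; lra.
  by split; lia.
(* Offset of the cell of [y] from that of [x], shifted by 1 to lie in [{0, 1, 2}]. *)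
pose D y : {ffun 'I_n -> 'I_3} := [ffun i => inord (absz (fl y i - fl x i + 1))].
rewrite (partition_big D predT)//=.
apply: (@le_trans _ _ (\sum_(p : {ffun 'I_n -> 'I_3}) c)); last first.
  by rewrite sumr_const card_ffun !card_ord mulr_natl.
apply: ler_sum => p _.
have [y /andP[xy /eqP yp]|none] :=
    pickP [pred y | (`|f x - f y| <= 2 ^- k) && (D y == p)]; last first.
  by rewrite big1// => y h; have := none y; rewrite /= h.
apply: le_trans (muc y).
rewrite [leLHS]big_mkcond [leRHS]big_mkcond/=; apply: ler_sum => z _.
case: ifP => [/andP[xz /eqP zp]|_]; last by case: ifP.
suff -> : cell k (f y) (f z) by [].
apply/cellP => i; have /ffunP/(_ i)/(congr1 (@nat_of_ord _)) := etrans yp (esym zp).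
rewrite -/(fl y i) -/(fl z i).
have [] := fl_near y i xy; have [] := fl_near z i xz; rewrite !ffunE.
move: (fl x i) (fl y i) (fl z i) => {xy xz zp yp} a b e h1 h2 h3 h4.
by rewrite !inordK; lia.
Qed.

Lemma dyadic_scale (R : realFieldType) (p m : nat) (t : R) :
  (p <= m)%N -> t <= 2 ^- p ->
  t <= 2 ^- m \/ exists2 k, (p <= k < m)%N & 2 ^- k.+1 < t <= 2 ^- k.
Proof.
move=> /subnK <-; elim: (m - p)%N => [|j IH] tp; first by left.
have [tj|[k pk tk]] := IH tp; last first.
  by right; exists k => //; move: pk; rewrite addSn; lia.
rewrite addSn; have [|h] := leP t (2 ^- (j + p).+1); first by left.
by right; exists (j + p)%N; [lia | rewrite h].
Qed.

Lemma geometric_tail_le (R : realFieldType) (rho : R) (p m : nat) :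
  0 <= rho -> rho < 1 -> (1 - rho) * \sum_(p <= k < m) rho ^+ k <= rho ^+ p.
Proof.
move=> r0 r1; have [pm|mp] := leqP p m; last first.
  by rewrite big_geq ?mulr0 ?exprn_ge0// ltnW.
rewrite mulr_sumr (eq_bigr (fun k => - (rho ^+ k.+1 - rho ^+ k))); last first.
  by move=> k _; rewrite exprS; ring.
by rewrite sumrN telescope_sumr// opprB lerBlDr lerDl exprn_ge0.
Qed.

(** Pairs are sorted by dyadic distance. Scale [k] contributes at most [K * 2 ^+ (d * k.+1)] times a
    ball mass [3 ^ n * q ^+ k], and these terms form a geometric series of ratio [q * 2 ^+ d]. The
    bound on [cnt] without a distance condition serves the pairs closer than [2 ^- m]. *)
Lemma energy_le (R : realType) (n d p m : nat) (X : finType)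
    (f : X -> 'rV[R]_n) (mu : X -> R) (q K : R) (cnt : X -> X -> R) (x : X) :
  (p <= m)%N -> 0 < q -> q * 2 ^+ d < 1 -> 0 <= K -> (forall y, 0 <= mu y) ->
  (forall k y, (k <= m)%N -> \sum_(z | cell k (f y) (f z)) mu z <= q ^+ k) ->
  (forall y, cnt x y <= K * 2 ^+ (d * m.+1)) ->
  (forall k y, (k < m)%N -> 2 ^- k.+1 < `|f x - f y| ->
     cnt x y <= K * 2 ^+ (d * k.+1)) ->
  (1 - q * 2 ^+ d) * \sum_(y | `|f x - f y| <= 2 ^- p) mu y * cnt x y <=
    K * 2 ^+ d * (3 ^ n)%:R * (q * 2 ^+ d) ^+ p.
Proof.
move=> pm q0 rho1 K0 mu0 muq cnt_all cnt_k; set rho := q * 2 ^+ d.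
have rho0 : 0 <= rho by rewrite mulr_ge0 ?exprn_ge0 ?ltW.
(* Summing over every scale above the distance, not only the matching one, leaves full balls to
   estimate. *)
have pt y : `|f x - f y| <= 2 ^- p -> cnt x y <=
    \sum_(p <= k < m.+1) (if `|f x - f y| <= 2 ^- k then K * 2 ^+ (d * k.+1) else 0).
  move=> xy; have term0 k :
      0 <= (if `|f x - f y| <= 2 ^- k then K * 2 ^+ (d * k.+1) else 0).
    by case: ifP => // _; rewrite mulr_ge0 ?exprn_ge0.
  have pick k : (p <= k <= m)%N -> `|f x - f y| <= 2 ^- k -> K * 2 ^+ (d * k.+1) <=
      \sum_(p <= k < m.+1) (if `|f x - f y| <= 2 ^- k then K * 2 ^+ (d * k.+1) else 0).
    move=> /andP[pk km] h.
    rewrite (big_cat_nat pk)/=; last by lia.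
    rewrite (big_ltn (m := k)) ?ltnS// h.
    rewrite addrCA lerDl addr_ge0//; apply: sumr_ge0 => i _; exact: term0.
  have [h|[k /andP[pk km] /andP[h1 h2]]] := dyadic_scale pm xy.
    by apply: le_trans (pick m _ h) => //; rewrite pm leqnn.
  by apply: le_trans (cnt_k _ _ km h1) (pick k _ h2); rewrite pk ltnW.
apply: (@le_trans _ _ ((1 - rho) *
    (K * 2 ^+ d * (3 ^ n)%:R * \sum_(p <= k < m.+1) rho ^+ k))); last first.
  by rewrite mulrCA ler_wpM2l ?geometric_tail_le// !mulr_ge0// exprn_ge0.
rewrite ler_wpM2l ?subr_ge0 ?(ltW rho1)//.
apply: (@le_trans _ _ (\sum_y mu y * \sum_(p <= k < m.+1)
    (if `|f x - f y| <= 2 ^- k then K * 2 ^+ (d * k.+1) else 0))).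
  rewrite big_mkcond/=; apply: ler_sum => y _; case: ifP => [xy|_].
    by rewrite ler_wpM2l// pt.
  rewrite mulr_ge0// sumr_ge0// => k _; case: ifP => // _.
  by rewrite mulr_ge0 ?exprn_ge0.
under eq_bigr do rewrite mulr_sumr.
rewrite exchange_big/= mulr_sumr !big_nat; apply: ler_sum => k /andP[pk km].
apply: (@le_trans _ _ (K * 2 ^+ (d * k.+1) * ((3 ^ n)%:R * q ^+ k))).
  apply: (@le_trans _ _ (K * 2 ^+ (d * k.+1) *
      \sum_(y | `|f x - f y| <= 2 ^- k) mu y)).
    rewrite [X in _ <= _ * _ * X]big_mkcond mulr_sumr; apply: ler_sum => y _.
    by case: ifP => _; rewrite ?mulr0// mulrC.
  apply: ler_wpM2l; first by rewrite mulr_ge0 ?exprn_ge0.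
  by apply: ball_mass => // [|y]; [rewrite exprn_ge0// ltW | apply: muq].
by rewrite /rho exprMn -exprM mulnS exprD le_eqVlt; apply/orP; left; apply/eqP; ring.
Qed.

(** * Euclidean geometry and reflections *)

Section Euclid.
Variables (R : realType) (n : nat).
Implicit Types (u v w c : 'rV[R]_n) (t : R).

Lemma edotC u v : edot u v = edot v u.
Proof. by apply: eq_bigr => i _; rewrite mulrC. Qed.

Lemma edotDl u v w : edot (u + v) w = edot u w + edot v w.
Proof. by rewrite -big_split; apply: eq_bigr => i _; rewrite mxE mulrDl. Qed.

Lemma edotZl t u w : edot (t *: u) w = t * edot u w.
Proof. by rewrite mulr_sumr; apply: eq_bigr => i _; rewrite mxE mulrA. Qed.

Lemma edotDr u v w : edot w (u + v) = edot w u + edot w v.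
Proof. by rewrite !(edotC w) edotDl. Qed.

Lemma edotZr t u w : edot w (t *: u) = t * edot w u.
Proof. by rewrite !(edotC w) edotZl. Qed.

Lemma edotNl u w : edot (- u) w = - edot u w.
Proof. by rewrite -scaleN1r edotZl mulN1r. Qed.

Lemma edotNr u w : edot w (- u) = - edot w u.
Proof. by rewrite !(edotC w) edotNl. Qed.

Definition edotE := (edotDl, edotDr, edotNl, edotNr, edotZl, edotZr).

Lemma edot_ge0 u : 0 <= edot u u.
Proof. by apply: sumr_ge0 => i _; rewrite -expr2 sqr_ge0. Qed.

Lemma edot_eq0 u : (edot u u == 0) = (u == 0).
Proof.
apply/eqP/eqP => [/eqP|->]; last by apply: big1 => i _; rewrite mxE mul0r.
rewrite psumr_eq0 => [/allP u0|i _]; last by rewrite -expr2 sqr_ge0.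
apply/rowP => i; rewrite mxE; apply/eqP; have := u0 i (mem_index_enum i).
by rewrite mulf_eq0 orbb.
Qed.

Lemma edot_gt0 u : (0 < edot u u) = (u != 0).
Proof. by rewrite lt_def edot_ge0 andbT edot_eq0. Qed.

Lemma sqr_enorm u : enorm u ^+ 2 = edot u u.
Proof. by rewrite sqr_sqrtr// edot_ge0. Qed.

Lemma enorm_ge0 u : 0 <= enorm u.
Proof. exact: sqrtr_ge0. Qed.

Lemma enorm_gt0 u : (0 < enorm u) = (u != 0).
Proof. by rewrite sqrtr_gt0 edot_gt0. Qed.

Lemma enormZ t u : enorm (t *: u) = `|t| * enorm u.
Proof. by rewrite /enorm !edotE mulrA -expr2 sqrtrM ?sqr_ge0// sqrtr_sqr. Qed.

Lemma enormN u : enorm (- u) = enorm u.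
Proof. by rewrite /enorm !edotE opprK. Qed.

Lemma edot_le u v : edot u v <= enorm u * enorm v.
Proof.
have [->|u0] := eqVneq u 0.
  by rewrite /edot big1 ?mulr_ge0 ?enorm_ge0// => i _; rewrite mxE mul0r.
have [->|v0] := eqVneq v 0.
  by rewrite /edot big1 ?mulr_ge0 ?enorm_ge0// => i _; rewrite mxE mulr0.
have := edot_ge0 (enorm v *: u - enorm u *: v).
rewrite !edotE -!sqr_enorm (edotC v u).
move: u0 v0; rewrite -!enorm_gt0; move: (enorm u) (enorm v) (edot u v) => a b e a0 b0.
set z := (X in 0 <= X); have -> : z = (a * b) * (2 * (a * b - e)) by rewrite /z; ring.
by rewrite pmulr_rge0 ?mulr_gt0// pmulr_rge0// subr_ge0.
Qed.

Lemma normr_edot_le u v : `|edot u v| <= enorm u * enorm v.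
Proof.
rewrite ler_norml edot_le andbT lerNl -edotNl.
by rewrite -(enormN u) edot_le.
Qed.

Lemma enormD u v : enorm (u + v) <= enorm u + enorm v.
Proof.
rewrite -(@ler_pXn2r _ 2)// ?nnegrE ?addr_ge0 ?enorm_ge0//.
rewrite sqr_enorm !edotE sqrrD !sqr_enorm (edotC v u).
by have := edot_le u v; lra.
Qed.

Lemma enormB u v : enorm u - enorm v <= enorm (u - v).
Proof. by rewrite lerBlDr -{1}(subrK v u) enormD. Qed.

Lemma norm_le_enorm v : `|v| <= enorm v.
Proof.
apply/rV_norm_leP => [|i]; first exact: enorm_ge0.
rewrite -(@ler_pXn2r _ 2)// ?nnegrE ?enorm_ge0// sqr_enorm real_normK ?num_real//.
rewrite /edot (bigD1 i)//= -expr2 lerDl sumr_ge0// => j _.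
by rewrite -expr2 sqr_ge0.
Qed.

Lemma enorm_le_norm v : enorm v <= n%:R * `|v|.
Proof.
rewrite -(@ler_pXn2r _ 2)// ?nnegrE ?enorm_ge0 ?mulr_ge0// sqr_enorm.
apply: (@le_trans _ _ (\sum_(i < n) `|v| ^+ 2)).
  apply: ler_sum => i _; rewrite -expr2 -real_normK ?num_real//.
  by rewrite ler_pXn2r// ?nnegrE// rV_coord_le_norm.
rewrite sumr_const card_ord -[_ *+ n]mulr_natl exprMn ler_wpM2r ?sqr_ge0//.
by rewrite -natrX ler_nat; case: (n) => // k; rewrite leq_pmulr.
Qed.

Definition reflection u c : 'rV[R]_n := c - (2 * edot c u / edot u u) *: u.

Lemma edot_reflection u a b : u != 0 ->
  edot (reflection u a) (reflection u b) = edot a b.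
Proof.
rewrite -edot_eq0 => u0; rewrite /reflection !edotE (edotC u b).
by field.
Qed.

(* [c - reflection u c] is a multiple of [u], so the reflected vector determines
   the line of [u], and hence [u] itself once one nonzero coordinate is fixed. *)
Lemma reflection_cluster c u w v (t s e tau : R) i0 :
  edot c c = 1 -> u 0 i0 = w 0 i0 -> 1 <= u 0 i0 ->
  (forall j, `|u 0 j| <= 3) -> (forall j, `|w 0 j| <= 3) ->
  1 / 2 <= `|edot c u| ->
  `|v - t *: reflection u c| <= e -> `|v - s *: reflection w c| <= e ->
  (0 < t) = (0 < s) -> 2 * n%:R * e <= tau -> 0 < tau -> tau <= `|v| ->
  forall j, `|u 0 j - w 0 j| <= 36 * n%:R * (8 * n%:R * e / tau).
Proof.
move=> c1 uw u1 u3 w3 cu.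
set th := reflection u c; set ph := reflection w c => vt vs ts etau tau0 vtau j.
have unz : u != 0.
  by apply: contraTneq u1 => ->; rewrite mxE -ltNge ltr01.
have wnz : w != 0.
  by apply: contraTneq u1 => w0; rewrite uw w0 mxE -ltNge ltr01.
have th1 : enorm th = 1 by rewrite /enorm edot_reflection// c1 sqrtr1.
have ph1 : enorm ph = 1 by rewrite /enorm edot_reflection// c1 sqrtr1.
have n0 : 0 <= n%:R :> R by [].
set E := n%:R * e.
have eE (x : 'rV[R]_n) : `|x| <= e -> enorm x <= E.
  by move=> h; apply: le_trans (enorm_le_norm x) _; rewrite ler_wpM2l.
have vtE := eE _ vt; have vsE := eE _ vs.
have nt : enorm (t *: th) = `|t| by rewrite enormZ th1 mulr1.
have ns : enorm (s *: ph) = `|s| by rewrite enormZ ph1 mulr1.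
have t1 : enorm v - `|t| <= E by rewrite -nt; apply: le_trans (enormB _ _) vtE.
have t2 : `|t| - enorm v <= E.
  by rewrite -nt; apply: le_trans (enormB _ _) _; rewrite -enormN opprB.
have s1 : enorm v - `|s| <= E by rewrite -ns; apply: le_trans (enormB _ _) vsE.
have s2 : `|s| - enorm v <= E.
  by rewrite -ns; apply: le_trans (enormB _ _) _; rewrite -enormN opprB.
have vE := norm_le_enorm v.
have E2 : 2 * E <= tau by rewrite /E mulrA.
have tau2 : tau / 2 <= `|t| by lra.
(* Both [|t|] and [|s|] are within [E] of [enorm v]; the common sign removes the absolute values. *)
have st : `|s - t| <= 2 * E.
  move: ts t1 t2 s1 s2; have [tp|tp] := ltP 0 t => /esym.
    move=> sp; rewrite (gtr0_norm tp) (gtr0_norm sp) => *.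
    by rewrite ler_norml; apply/andP; split; lra.
  move=> /negbT; rewrite -leNgt => sp; rewrite (ler0_norm tp) (ler0_norm sp) => *.
  by rewrite ler_norml; apply/andP; split; lra.
have thph : enorm (t *: (th - ph)) <= 4 * E.
  have -> : t *: (th - ph) = - (v - t *: th) + ((v - s *: ph) + (s - t) *: ph).
    by apply/rowP => i; rewrite !mxE; ring.
  apply: le_trans (enormD _ _) _; rewrite enormN.
  have := enormD (v - s *: ph) ((s - t) *: ph).
  by rewrite enormZ ph1 mulr1; lra.
(* The bound [4 * E] on [t *: (th - ph)] divided by [|t| >= tau / 2]. *)
set e1 := 8 * n%:R * e / tau.
have E0 : 0 <= E by apply: le_trans vtE; apply: enorm_ge0.
have e10 : 0 <= e1.
  by rewrite /e1 -(mulrA 8) -/E; apply: divr_ge0; [apply: mulr_ge0 | apply: ltW].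
have thj i : `|th 0 i - ph 0 i| <= e1.
  rewrite /e1 -(mulrA 8) -/E ler_pdivlMr//.
  have := le_trans (rV_coord_le_norm (t *: (th - ph)) i)
    (le_trans (norm_le_enorm _) thph).
  rewrite !mxE normrM; have := normr_ge0 (th 0 i - ph 0 i).
  by move: tau2; move: `|t| `|_ - _| => a b; nra.
pose sg := 2 * edot c u / edot u u; pose sh := 2 * edot c w / edot w w.
have zj i : `|sg * u 0 i - sh * w 0 i| <= e1.
  have := thj i; rewrite /th /ph /reflection !mxE -/sg -/sh.
  by rewrite -normrN; congr (`| _ | <= _); ring.
(* At [i0] the vectors [u] and [w] share a coordinate of size at least 1, which isolates the
   coefficients. *)
have sgsh : `|sg - sh| <= e1.
  apply: le_trans (zj i0); rewrite -uw -mulrBl normrM ler_peMr//.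
  by rewrite (le_trans u1)// ler_norm.
have uu9 : edot u u <= 9 * n%:R.
  rewrite mulrC mulr_natl; have := @sumr_const R 'I_n predT 9; rewrite card_ord => <-.
  apply: ler_sum => i _; rewrite -expr2 -real_normK ?num_real//.
  by have := u3 i; have := normr_ge0 (u 0 i); nra.
have uu0 : 0 < edot u u by rewrite edot_gt0.
have sg9 : 1 <= 9 * n%:R * `|sg|.
  rewrite /sg normrM normfV (gtr0_norm uu0) mulrA ler_pdivlMr// mul1r.
  apply: le_trans uu9 _; rewrite ler_peMr// ?mulr_ge0// normrM gtr0_norm//.
  by move: cu; lra.
have : `|sg| * `|u 0 j - w 0 j| <= 4 * e1.
  rewrite -normrM.
  have -> : sg * (u 0 j - w 0 j) = (sg * u 0 j - sh * w 0 j) - (sg - sh) * w 0 j by ring.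
  apply: le_trans (ler_normB _ _) _; rewrite normrM.
  have := zj j; have := w3 j; have := normr_ge0 (w 0 j); have := normr_ge0 (sg - sh).
  by move: sgsh; move: `|sg - sh| `|w 0 j| `|_| => x y z *; nra.
move=> h; have h2 := normr_ge0 (u 0 j - w 0 j).
apply: (@le_trans _ _ (9 * n%:R * `|sg| * `|u 0 j - w 0 j|)).
  by rewrite ler_peMl.
have -> : 36 * n%:R * e1 = 9 * n%:R * (4 * e1) by ring.
by rewrite -mulrA ler_wpM2l// mulr_ge0.
Qed.

End Euclid.

(** * Directions in a tube *)

(** Each coordinate of [u0] moves by at most [1 / (2 * d.+1)], so the product with a unit vector
    changes by at most 1/2 and the products bounded below at [u0] stay away from 0 on the whole
    grid. *)
Definition grid_pt (R : realType) (d m : nat) (u0 : 'rV[R]_d.+1)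
    (g : {ffun 'I_d.+1 -> 'I_(2 ^ m)}) : 'rV[R]_d.+1 :=
  \row_j (u0 0 j + (g j)%:R / (2 * d.+1%:R * 2 ^+ m)).

(** Here [t] may have either sign: the tube surrounds a full line, whereas [unseen] below uses a
    ray. *)
Definition in_tube (R : realType) (n : nat) (e : R) (th v : 'rV[R]_n) : bool :=
  `[< exists t : R, `|v - t *: th| <= e >].

(* Fix coordinate [0] of [g] and the sign of [t]: if [`|v| > 2 ^- k.+1], the other
   coordinates of the grid indices whose tube contains [v] vary by at most
   [L = 576 * d.+1 ^ 3 * 2 ^ k.+1], so there are at most [2 * 2 ^ m * L.+1 ^ d] of
   them. *)
Definition tube_const (d : nat) : nat := 2 * (577 * d.+1 ^ 3) ^ d.

Lemma leq_exp2r_homo (a b e : nat) : (a <= b)%N -> (a ^ e <= b ^ e)%N.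
Proof. by case: e => // e ab; rewrite leq_exp2r. Qed.

Section Grid.
Variables (R : realType) (d m : nat) (u0 : 'rV[R]_d.+1).
Hypotheses (u0_1 : 1 <= u0 0 ord0) (u0_2 : forall j, `|u0 0 j| <= 2).

Implicit Type g : {ffun 'I_d.+1 -> 'I_(2 ^ m)}.

Lemma grid_offset g j :
  0 <= (g j)%:R / (2 * d.+1%:R * 2 ^+ m : R) <= 1 / (2 * d.+1%:R).
Proof.
have m0 : 0 < 2 ^+ m :> R by rewrite exprn_gt0.
have d0 : 0 < d.+1%:R :> R by [].
apply/andP; split; first by rewrite divr_ge0 ?mulr_ge0// ltW.
rewrite ler_pdivrMr ?mulr_gt0//.
have -> : 1 / (2 * d.+1%:R) * (2 * d.+1%:R * 2 ^+ m) = 2 ^+ m :> R.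
  by move: (d.+1%:R) d0 => D D0; field; rewrite gt_eqF.
by rewrite -natrX ler_nat ltnW.
Qed.

Lemma grid_pt_coord0 g : 1 <= grid_pt u0 g 0 ord0.
Proof.
by rewrite mxE; have /andP[h _] := grid_offset g ord0; rewrite (le_trans u0_1)// lerDl.
Qed.

Lemma grid_pt_bounded g j : `|grid_pt u0 g 0 j| <= 3.
Proof.
rewrite mxE; apply: le_trans (ler_normD _ _) _.
have /andP[h1 h2] := grid_offset g j; rewrite (ger0_norm h1).
suff h3 : 1 / (2 * d.+1%:R) <= 1 :> R.
  by rewrite (_ : 3 = 2 + 1)%R ?lerD// ?(le_trans h2)//; ring.
by rewrite ler_pdivrMr ?mulr_gt0// mul1r -natrM ler1n.
Qed.

Lemma grid_pt_neq0 g : grid_pt u0 g != 0.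
Proof.
by apply: contraTneq (grid_pt_coord0 g) => ->; rewrite mxE -ltNge ltr01.
Qed.

Lemma grid_pt_dot c g : edot c c = 1 -> 1 <= `|edot c u0| ->
  1 / 2 <= `|edot c (grid_pt u0 g)|.
Proof.
move=> c1 cu.
have -> : edot c (grid_pt u0 g) =
    edot c u0 + \sum_j c 0 j * ((g j)%:R / (2 * d.+1%:R * 2 ^+ m)).
  by rewrite -big_split; apply: eq_bigr => j _; rewrite mxE mulrDr.
set S := \sum_j _; suff : `|S| <= 1 / 2.
  by have := lerB_normD (edot c u0) S; lra.
apply: le_trans (ler_norm_sum _ _ _) _.
apply: (@le_trans _ _ (\sum_(j < d.+1) 1 / (2 * d.+1%:R))); last first.
  rewrite sumr_const card_ord -[_ *+ _]mulr_natr.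
  have : 0 < d.+1%:R :> R by [].
  move: (d.+1%:R) => D D0; rewrite (_ : _ * D = 1 / 2)//.
  by field; rewrite gt_eqF.
apply: ler_sum => j _; have /andP[h1 h2] := grid_offset g j.
rewrite normrM (ger0_norm h1); apply: le_trans h2; rewrite ler_piMl//.
apply: le_trans (rV_coord_le_norm c j) (le_trans (norm_le_enorm c) _).
by rewrite /enorm c1 sqrtr1.
Qed.

Lemma card_grid_tube (c v : 'rV[R]_d.+1) k :
  edot c c = 1 -> 1 <= `|edot c u0| -> (k < m)%N -> 2 ^- k.+1 < `|v| ->
  (#|[set g : {ffun 'I_d.+1 -> 'I_(2 ^ m)} |
       in_tube (2 ^- m) (reflection (grid_pt u0 g) c) v]|
   <= 2 ^ m * tube_const d * 2 ^ (d * k.+1))%N.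
Proof.
rewrite /tube_const => c1 cu km vk; set S := [set g | _].
(* If [2 ^ m] is small, counting all grid indices suffices. Otherwise [2 ^- m] is small enough
   against [2 ^- k.+1] for [reflection_cluster]. *)
have [small|large] := ltnP (2 ^ m) (2 * d.+1 * 2 ^ k.+1).
  apply: leq_trans (max_card _) _; rewrite card_ffun !card_ord expnS.
  rewrite -!mulnA leq_mul2l; apply/orP; right.
  apply: leq_trans (leq_exp2r_homo d (ltnW small)) _.
  rewrite expnMn -expnM [(k.+1 * d)%N]mulnC mulnA leq_mul2r; apply/orP; right.
  by apply: leq_trans (leq_pmull _ (isT : (0 < 2)%N)); apply: leq_exp2r_homo; nia.
pose L := (576 * d.+1 ^ 3 * 2 ^ k.+1)%N.
have m0 : 0 < 2 ^+ m :> R by rewrite exprn_gt0.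
have k0 : 0 < 2 ^+ k.+1 :> R by rewrite exprn_gt0.
pose sg g := `[< exists2 t : R, 0 < t &
  `|v - t *: reflection (grid_pt u0 g) c| <= 2 ^- m >].
have clu : {in S &, forall g h, sg g = sg h -> g ord0 = h ord0 ->
     forall j, (g j <= h j + L)%N}.
  move=> g h; rewrite !inE /in_tube => -[t0 gt0] [s0 hs0] sgE g0 j.
  (* If no positive parameter works for [g], then none works for [h] either, and both given
     parameters are nonpositive. *)
  have [t [s [gt hs ts]]] : exists t s : R,
      [/\ `|v - t *: reflection (grid_pt u0 g) c| <= 2 ^- m,
          `|v - s *: reflection (grid_pt u0 h) c| <= 2 ^- m & (0 < t) = (0 < s)].
    have [sgg|/asboolPn sgg] := boolP (sg g).
      have /asboolP[s sp hs] : sg h by rewrite -sgE.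
      by have /asboolP[t tp gt] := sgg; exists t, s; rewrite tp sp.
    have /asboolPn sgh : ~~ sg h by rewrite -sgE; apply/asboolPn.
    exists t0, s0; split=> //; transitivity false; [|symmetry]; apply/negbTE/negP => hp.
      by apply: sgg; exists t0.
    by apply: sgh; exists s0.
  have uw : grid_pt u0 g 0 ord0 = grid_pt u0 h 0 ord0 by rewrite !mxE g0.
  have etau : 2 * d.+1%:R * 2 ^- m <= 2 ^- k.+1 :> R.
    rewrite ler_pdivrMr// [leRHS]mulrC ler_pdivlMr//.
    by rewrite -!natrX -!natrM ler_nat.
  have := reflection_cluster c1 uw (grid_pt_coord0 g) (grid_pt_bounded g)
    (grid_pt_bounded h) (grid_pt_dot g c1 cu) gt hs ts etau _ (ltW vk) j.
  rewrite invr_gt0 => /(_ k0); rewrite !mxE.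
  have -> : u0 0 j + (g j)%:R / (2 * d.+1%:R * 2 ^+ m)
      - (u0 0 j + (h j)%:R / (2 * d.+1%:R * 2 ^+ m)) =
      ((g j)%:R - (h j)%:R) / (2 * d.+1%:R * 2 ^+ m) by ring.
  move=> /(le_trans (ler_norm _)); rewrite ler_pdivrMr; last by rewrite !mulr_gt0.
  (* Measured in grid steps, the bound of [reflection_cluster] is exactly [L]. *)
  have -> : 36 * d.+1%:R * (8 * d.+1%:R * 2 ^- m / 2 ^- k.+1) *
      (2 * d.+1%:R * 2 ^+ m) = L%:R :> R.
    rewrite /L !natrM !natrX; have : 0 < d.+1%:R :> R by [].
    by move: (d.+1%:R) => D D0; field; rewrite !gt_eqF.
  by rewrite lerBlDr -natrD ler_nat addnC.
apply: leq_trans (card_grid_cluster clu) _.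
rewrite (mulnC 2 (2 ^ m)%N) -!mulnA !leq_mul2l; apply/orP; right; apply/orP; right.
rewrite mulnC [(d * _)%N]mulnC expnM -expnMn mulnC; apply: leq_exp2r_homo.
rewrite /L; have : (0 < d.+1 ^ 3 * 2 ^ k.+1)%N by rewrite muln_gt0 !expn_gt0.
by rewrite -!mulnA; lia.
Qed.

End Grid.

(** Project along [th] onto the hyperplane where coordinate [i] vanishes and round at scale
    [2 ^- m]. Taking [i] with [|th 0 i|] maximal keeps the slopes at most 1, so projections of
    points of norm at most [M] have norm at most [2 * M]. *)
Lemma direction_buckets (R : realType) (d m M : nat) (th : 'rV[R]_d.+1) :
  th != 0 -> exists b : 'rV[R]_d.+1 -> {ffun 'I_d -> 'I_(4 * M * 2 ^ m).+1},
    forall x y, `|x| <= M%:R -> `|y| <= M%:R -> b x = b y ->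
      in_tube (2 ^- m) th (x - y).
Proof.
move=> th0; have m0 : 0 < 2 ^+ m :> R by rewrite exprn_gt0.
have [i imax] : exists i, forall j, `|th 0 j| <= `|th 0 i|.
  have [i _ h] := @arg_maxP _ _ _ (@ord0 d) predT (fun i => `|th 0 i|) erefl.
  by exists i => j; apply: h.
have thi : 0 < `|th 0 i|.
  rewrite lt_def normr_ge0 andbT; apply: contraNneq th0 => thi.
  apply/eqP/rowP => j; rewrite mxE; apply/eqP; rewrite -normr_le0 -thi.
  exact: imax.
pose G (x : 'rV[R]_d.+1) j := x 0 j - x 0 i * (th 0 j / th 0 i).
have G_le x j : `|x| <= M%:R -> `|G x j| <= 2 * M%:R.
  move=> xM; apply: le_trans (ler_normB _ _) _; rewrite normrM.
  have := le_trans (rV_coord_le_norm x j) xM.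
  have := le_trans (rV_coord_le_norm x i) xM.
  have : `|th 0 j / th 0 i| <= 1.
    by rewrite normrM normfV ler_pdivrMr// mul1r.
  move: (normr_ge0 (th 0 j / th 0 i)) (normr_ge0 (x 0 i)).
  by move: `|th 0 j / _| `|x 0 i| `|x 0 j| => a b c *; nra.
exists (fun x => [ffun j : 'I_d =>
  inord (absz (Num.floor (2 ^+ m * (G x (lift i j) + 2 * M%:R))))]).
move=> x y xM yM /ffunP bE; apply/asboolP; exists ((x 0 i - y 0 i) / th 0 i).
apply/rV_norm_leP => [|j]; first by rewrite invr_ge0 ltW.
rewrite !mxE; have [k ->|->] := unliftP i j; last first.
  by rewrite mulfVK -?normr_gt0// subrr normr0 invr_ge0 ltW.
set l := lift i k.
have -> : x 0 l - y 0 l - (x 0 i - y 0 i) / th 0 i * th 0 l = G x l - G y l.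
  by rewrite /G; ring.
have fl_bd z : `|z| <= M%:R ->
    0 <= Num.floor (2 ^+ m * (G z l + 2 * M%:R)) <= (4 * M * 2 ^ m)%:Z.
  move=> zM; have := G_le z l zM; rewrite ler_norml => /andP[h1 h2].
  apply/andP; split; first by rewrite floor_ge0 mulr_ge0 ?(ltW m0)//; lra.
  rewrite -(ler_int R); apply: le_trans (floor_le _) _.
  rewrite -pmulrn !natrM natrX mulrC ler_wpM2r ?(ltW m0)//; lra.
have := congr1 (@nat_of_ord _) (bE k); rewrite !ffunE -/l.
have := floor_itv (2 ^+ m * (G x l + 2 * M%:R)).
have := floor_itv (2 ^+ m * (G y l + 2 * M%:R)).
have := fl_bd x xM; have := fl_bd y yM.
move: (Num.floor (2 ^+ m * (G x l + _))) (Num.floor (2 ^+ m * (G y l + _))).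
move=> a b ha hb; rewrite !inordK; [|lia|lia] => h1 h2 abE.
have {abE} abE : a = b by lia.
move: h1 h2; rewrite abE rmorphD/= => /andP[h1 h2] /andP[h3 h4].
rewrite -(ler_pM2l m0) mulfV ?gt_eqF// -{1}(gtr0_norm m0) -normrM.
by rewrite ler_norml; apply/andP; split; lra.
Qed.

(** * Compactness and forbidden angles *)

Section AngleGap.
Variables (R : realType) (n : nat).
Implicit Types (u v x y z : 'rV[R]_n) (A : set 'rV[R]_n) (alpha : R).

Lemma cos_angle u v : u != 0 -> v != 0 ->
  cos (angle u v) = edot u v / (enorm u * enorm v).
Proof.
rewrite -!enorm_gt0 => u0 v0; have uv0 := mulr_gt0 u0 v0; rewrite /angle acosK//.
rewrite in_itv/= -ler_norml normrM normfV (gtr0_norm uv0).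
by rewrite ler_pdivrMr// mul1r normr_edot_le.
Qed.

(** An angle [pi] at [x] puts [x] between [y] and [z], so the angle at [y] is 0. *)
Lemma contains_angle_pi0 A : contains_angle A pi -> contains_angle A 0.
Proof.
move=> [x [y [z [[Ax Ay Az] [[xy xz yz] ang]]]]].
have u0 : y - x != 0 by rewrite subr_eq0 eq_sym.
have v0 : z - x != 0 by rewrite subr_eq0 eq_sym.
have := cos_angle u0 v0; rewrite ang cospi.
have zy : z - y = (z - x) - (y - x) by rewrite opprB addrA subrK.
move=> uvE; exists y, x, z; split=> //; split; first by rewrite eq_sym.
rewrite /angle zy -(opprB y x); move: u0 v0 uvE; rewrite -!enorm_gt0.
move: (y - x) (z - x) => u v u0 v0 uvE.
have uv : edot u v = - (enorm u * enorm v).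
  by rewrite -mulN1r uvE divfK// gt_eqF// mulr_gt0.
(* The equality case of Cauchy-Schwarz. *)
have lin : enorm v *: u + enorm u *: v = 0.
  apply/eqP; rewrite -edot_eq0 !edotE (edotC v u) uv -!sqr_enorm; apply/eqP; ring.
pose l := 1 + enorm v / enorm u.
have -> : v - u = - (l *: u).
  apply/rowP => i; have /rowP/(_ i) := lin; rewrite !mxE /l => h.
  apply: (mulfI (lt0r_neq0 u0)); have -> : enorm u * (v 0 i - u 0 i) =
    (enorm v * u 0 i + enorm u * v 0 i) - (enorm v + enorm u) * u 0 i by ring.
  by rewrite h; field; rewrite gt_eqF.
have l0 : 0 < l by rewrite addr_gt0// divr_gt0.
rewrite !enormN enormZ !edotE opprK -sqr_enorm gtr0_norm//.
rewrite (_ : _ / _ = 1) ?acos1//; field.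
by rewrite !gt_eqF.
Qed.

(** The angle equation cleared of its denominator, hence continuous even where a leg vanishes. *)
Let F (c : R) (p : 'rV[R]_n * 'rV[R]_n * 'rV[R]_n) : R :=
  edot (p.1.2 - p.1.1) (p.2 - p.1.1)
    - c * (enorm (p.1.2 - p.1.1) * enorm (p.2 - p.1.1)).

Let leg1_continuous :
  continuous (fun p : 'rV[R]_n * 'rV[R]_n * 'rV[R]_n => p.1.2 - p.1.1).
Proof.
move=> p; apply: cvgB.
  by apply: (@continuous_comp _ _ _ fst snd p); [apply: cvg_fst | apply: cvg_snd].
by apply: (@continuous_comp _ _ _ fst fst p); [apply: cvg_fst | apply: cvg_fst].
Qed.

Let leg2_continuous :
  continuous (fun p : 'rV[R]_n * 'rV[R]_n * 'rV[R]_n => p.2 - p.1.1).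
Proof.
move=> p; apply: cvgB; first exact: cvg_snd.
by apply: (@continuous_comp _ _ _ fst fst p); [apply: cvg_fst | apply: cvg_fst].
Qed.

Lemma edot_continuous (T : topologicalType) (f g : T -> 'rV[R]_n) :
  continuous f -> continuous g -> continuous (fun p => edot (f p) (g p)).
Proof.
move=> fc gc.
apply: (@continuous_big R 'I_n +%R 0 xpredT _ T (index_enum 'I_n)
  (fun i p => f p 0 i * g p 0 i)) => [|i _ p]; first exact: add_continuous.
apply: cvgM.
  exact: (continuous_comp (fc p) (@coord_continuous _ _ _ 0 i _)).
exact: (continuous_comp (gc p) (@coord_continuous _ _ _ 0 i _)).
Qed.

Lemma enorm_continuous (T : topologicalType) (f : T -> 'rV[R]_n) :
  continuous f -> continuous (fun p => enorm (f p)).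
Proof.
move=> fc p; apply: (@continuous_comp _ _ _ (fun p => edot (f p) (f p)) Num.sqrt p).
  exact: edot_continuous.
exact: sqrt_continuous.
Qed.

Let F_continuous c : continuous (F c).
Proof.
move=> p; apply: cvgB.
  exact: (edot_continuous leg1_continuous leg2_continuous).
apply: cvgM; first exact: cvg_cst.
apply: cvgM; first exact: (enorm_continuous leg1_continuous).
exact: (enorm_continuous leg2_continuous).
Qed.

(** Triples in [A] with both legs of length at least [r] form a compact set on which the continuous
    defect does not vanish. *)
Lemma angle_defect_gap A alpha (r : R) :
  compact A -> 0 < alpha <= pi -> ~ contains_angle A alpha -> 0 < r ->
  exists2 f0 : R, 0 < f0 & forall x y z, A x -> A y -> A z ->
    r <= `|y - x| -> r <= `|z - x| ->
    f0 <= `|edot (y - x) (z - x) - cos alpha * (enorm (y - x) * enorm (z - x))|.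
Proof.
move=> cA /andP[a0 api] noA r0.
pose K := ((A `*` A `*` A) `&`
  [set p | r <= `|p.1.2 - p.1.1| /\ r <= `|p.2 - p.1.1|])%classic.
have cK : compact K.
  apply: compact_closedI; first by do 2!apply: compact_setX => //.
  have closed_far (f : 'rV[R]_n * 'rV[R]_n * 'rV[R]_n -> 'rV[R]_n) :
      continuous f -> closed [set p | r <= `|f p|]%classic.
    move=> fc; apply: (@preimage_closed _ _ (fun p => `|f p|) [set t | r <= t]%classic).
      by move=> p _; apply: (continuous_comp (fc p)); apply: norm_continuous.
    exact: closed_ge.
  exact: closedI (closed_far _ leg1_continuous) (closed_far _ leg2_continuous).
have cFK : compact (F (cos alpha) @` K)%classic.
  by apply: continuous_compact => //; apply: continuous_subspaceT; apply: F_continuous.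
have nF0 : ~ (F (cos alpha) @` K)%classic 0.
  move=> [[[x y] z] /= [[[Ax Ay] Az] [/= xy xz]]]; rewrite /F/= => F0.
  have u0 : y - x != 0 by rewrite -normr_gt0 (lt_le_trans r0).
  have v0 : z - x != 0 by rewrite -normr_gt0 (lt_le_trans r0).
  have ang : angle (y - x) (z - x) = alpha.
    have /eqP := F0; rewrite subr_eq0 => /eqP F1.
    rewrite /angle F1 mulfK ?cosK// ?in_itv/= ?(ltW a0)//.
    by rewrite mulf_neq0// gt_eqF// enorm_gt0.
  apply: noA; exists x, y, z; split=> //; split=> //; split.
  - by rewrite eq_sym -subr_eq0.
  - by rewrite eq_sym -subr_eq0.
  (* Coinciding endpoints would give the angle 0, excluded by [0 < alpha]. *)
  - apply/eqP => yz; move: ang; rewrite -yz /angle -expr2 sqr_enorm mulfV ?edot_eq0//.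
    by rewrite acos1 => a0'; move: a0; rewrite -a0' ltxx.
(* Separating 0 from the compact image also covers the case of an empty [K]. *)
have : nbhs (0 : R) (~` (F (cos alpha) @` K))%classic.
  apply: open_nbhs_nbhs; split => //; apply: closed_openC.
  exact: compact_closed.
move=> /nbhs_ballP[e/= e0 he]; exists e => // x y z Ax Ay Az xy xz.
rewrite leNgt; apply/negP => lt; apply: (he (F (cos alpha) (x, y, z))).
  by rewrite /ball/= sub0r normrN.
by exists (x, y, z).
Qed.

End AngleGap.

Lemma compact_nat_bound (R : realType) (n : nat) (A : set 'rV[R]_n) :
  compact A -> exists M : nat, forall x, A x -> `|x| <= M%:R.
Proof.
move=> /compact_bounded[B [_ AB]].
have B1 : B < (Num.truncn (`|B| + 1)).+1%:R.
  by apply: lt_trans (truncnS_gt _); rewrite (le_lt_trans (ler_norm B))// ltrDl.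
by exists (Num.truncn (`|B| + 1)).+1 => x Ax; apply: (AB _ B1).
Qed.

(** Legs nearly along [th] and [ph] would have an angle defect below the gap [f0]. *)
Lemma ray_gap (R : realType) (n : nat) (A : set 'rV[R]_n) (alpha r : R) :
  compact A -> 0 < alpha <= pi -> ~ contains_angle A alpha -> 0 < r ->
  exists2 eta : R, 0 < eta & forall (x y z th ph : 'rV[R]_n) (t s : R),
    A x -> A y -> A z ->
    edot th th = 1 -> edot ph ph = 1 -> edot th ph = cos alpha ->
    0 < t -> 0 < s -> r <= `|y - x| -> r <= `|z - x| ->
    `|(y - x) - t *: th| <= eta -> `|(z - x) - s *: ph| <= eta -> False.
Proof.
move=> cA ha noA r0; have [M AM] := compact_nat_bound cA.
have [f0 f00 gap] := angle_defect_gap cA ha noA r0.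
(* [D] bounds Euclidean distances in [A] and [E] the Euclidean errors. With [t, s <= D + E] and
   [E <= 1], the defect is at most [4 * D * E + 6 * E], strictly below [(4 * D + 7) * E]. *)
pose D : R := n%:R * (2 * M%:R); pose E := Num.min 1 (f0 / (4 * D + 7)).
have D0 : 0 <= D by rewrite !mulr_ge0.
have D7 : 0 < 4 * D + 7 by lra.
have E0 : 0 < E by rewrite lt_min ltr01 divr_gt0.
have E1 : E <= 1 by rewrite ge_min lexx.
have E2 : (4 * D + 7) * E <= f0.
  by rewrite mulrC -ler_pdivlMr// ge_min lexx orbT.
exists (E / n.+1%:R) => [|x y z th ph t s Ax Ay Az th1 ph1 thph t0 s0 xy xz et es].
  by rewrite divr_gt0.
have nE (v : 'rV[R]_n) : `|v| <= E / n.+1%:R -> enorm v <= E.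
  move=> h; apply: le_trans (enorm_le_norm v) _.
  apply: (@le_trans _ _ (n.+1%:R * (E / n.+1%:R))); last by rewrite mulrC divfK.
  by apply: ler_pM => //; rewrite ler_nat leqnSn.
have enD v w : A v -> A w -> enorm (v - w) <= D.
  move=> /AM vM /AM wM; apply: le_trans (enorm_le_norm _) _.
  by rewrite ler_wpM2l//; apply: le_trans (ler_normB _ _) _; lra.
have /enD /(_ Ax) pD := Ay; have /enD /(_ Ax) qD := Az.
have := gap x y z Ax Ay Az xy xz; apply/negP; rewrite -ltNge.
move: et es pD qD; rewrite -(subrK (t *: th) (y - x)) -(subrK (s *: ph) (z - x)).
rewrite !addrK.
move: (y - x - _) (z - x - _) => e f /nE eE /nE fE.
have th1' : enorm th = 1 by rewrite /enorm th1 sqrtr1.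
have ph1' : enorm ph = 1 by rewrite /enorm ph1 sqrtr1.
have nt : enorm (t *: th) = t by rewrite enormZ th1' mulr1 gtr0_norm.
have ns : enorm (s *: ph) = s by rewrite enormZ ph1' mulr1 gtr0_norm.
have a1 := enormD e (t *: th); have b1 := enormD f (s *: ph).
have a2 := enormB (e + t *: th) e; have b2 := enormB (f + s *: ph) f.
have a3 := enormB (t *: th) (- e); have b3 := enormB (s *: ph) (- f).
rewrite !opprK !enormN ![_ *: _ + _]addrC nt ns in a1 a3 b1 b3.
have ef := normr_edot_le e f.
have eph := normr_edot_le e ph; have thf := normr_edot_le th f.
rewrite ph1' mulr1 in eph; rewrite th1' mul1r in thf.
have c1 : `|cos alpha| <= 1 by rewrite ler_norml cos_geN1 cos_le1.
move=> pD qD; rewrite !edotE thph.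
move: (enorm (e + _)) (enorm (f + _)) a1 a3 b1 b3 pD qD => a b a1 a3 b1 b3 pD qD.
have e0 := enorm_ge0 e; have g0 := enorm_ge0 f.
set ne := enorm e in eE a1 a3 e0 ef eph; set nf := enorm f in fE b1 b3 g0 ef thf.
have efE : ne * nf <= E * E by apply: ler_pM.
have X1 : `|edot e f + s * edot e ph + t * edot th f| <= E * E + s * E + t * E.
  apply: le_trans (ler_normD _ _) _; apply: lerD.
    apply: le_trans (ler_normD _ _) _; apply: lerD; first exact: le_trans ef efE.
    by rewrite normrM gtr0_norm// ler_wpM2l ?(ltW s0)// (le_trans eph).
  by rewrite normrM gtr0_norm// ler_wpM2l ?(ltW t0)// (le_trans thf).
have X2 : `|t * s - a * b| <= t * E + s * E + E * E.
  have -> : t * s - a * b = - (t * (b - s) + s * (a - t) + (a - t) * (b - s)) by ring.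
  have aE : `|a - t| <= E by rewrite ler_norml; apply/andP; split; lra.
  have bE : `|b - s| <= E by rewrite ler_norml; apply/andP; split; lra.
  rewrite normrN; apply: le_trans (ler_normD _ _) _; apply: lerD; last first.
    by rewrite normrM ler_pM.
  apply: le_trans (ler_normD _ _) _.
  by rewrite !normrM (gtr0_norm t0) (gtr0_norm s0) lerD// ler_wpM2l// ltW.
set Z := (X in `|X| < _).
have -> : Z = (edot e f + s * edot e ph + t * edot th f)
    + cos alpha * (t * s - a * b) by rewrite /Z; ring.
apply: le_lt_trans (ler_normD _ _) _; rewrite normrM.
have X3 : `|cos alpha| * `|t * s - a * b| <= t * E + s * E + E * E.
  by apply: le_trans X2; rewrite ler_piMl.
have tD : t <= D + E by lra.
have sD : s <= D + E by lra.
have tE : t * E <= (D + E) * E by rewrite ler_wpM2r// ltW.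
have sE : s * E <= (D + E) * E by rewrite ler_wpM2r// ltW.
have EE : E * E <= E by rewrite ler_piMl// ltW.
by apply: lt_le_trans E2; rewrite mulrDl; nra.
Qed.

(** * Covering sets that avoid an angle *)

(** A bounded set meets finitely many cells; [X] consists of the codes of those met, and [f] chooses
    a point of [A] in each. *)
Lemma finite_net (R : realType) (n m : nat) (A : set 'rV[R]_n) (M : nat) :
  (forall x, A x -> `|x| <= M%:R) ->
  exists (X : finType) (f : X -> 'rV[R]_n),
    (forall i, A (f i)) /\ forall x, A x -> exists i, cell m (f i) x.
Proof.
move=> AM; have m0 : 0 < 2 ^+ m :> R by rewrite exprn_gt0.
pose fl (x : 'rV[R]_n) i := Num.floor (2 ^+ m * x 0 i).
pose code (x : 'rV[R]_n) : {ffun 'I_n -> 'I_(2 * M * 2 ^ m).+1} :=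
  [ffun i => inord (absz (fl x i + (M * 2 ^ m)%:Z))].
have fl_bd x i : A x -> - (M * 2 ^ m)%:Z <= fl x i <= (M * 2 ^ m)%:Z.
  move=> /AM xM; have := le_trans (rV_coord_le_norm x i) xM.
  rewrite ler_norml => /andP[h1 h2]; rewrite floor_ge_int -(ler_int R).
  rewrite rmorphN/= -pmulrn natrM natrX [(M%:R * _)%R]mulrC -mulrN.
  rewrite ler_pM2l// h1/=; apply: le_trans (floor_le _) _.
  by rewrite ler_pM2l.
pose P c := `[< exists2 x, A x & code x = c >].
have fP (c : {c | P c}) : exists x, A x /\ code x = val c.
  by have /asboolP[x Ax xc] := valP c; exists x.
exists {c | P c}, (fun c => projT1 (cid (fP c))); split=> [c|x Ax].
  by case: cid => x [].
have Pc : P (code x) by apply/asboolP; exists x.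
exists (Sub (code x) Pc); case: cid => y /= [Ay /ffunP yx].
apply/cellP => i; have := congr1 (@nat_of_ord _) (yx i); rewrite !ffunE.
have := fl_bd x i Ax; have := fl_bd y i Ay; rewrite -/(fl x i) -/(fl y i).
by move: (fl x i) (fl y i) => a b ha hb; rewrite !inordK; lia.
Qed.

Lemma small_geometric (R : realType) (rho C e : R) :
  0 <= rho -> rho < 1 -> 0 < e -> exists p : nat, C * rho ^+ p < e.
Proof.
move=> r0 r1 e0.
have : ((fun p => C * rho ^+ p) @ \oo --> C * 0)%classic.
  by apply: cvgM; [apply: cvg_cst | apply: cvg_expr; rewrite ger0_norm].
rewrite mulr0 => /cvgrPdist_lt /(_ e e0) [N _ h].
exists N; have := h N (leqnn N); rewrite /= sub0r normrN.
exact: le_lt_trans (ler_norm _).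
Qed.

(** The vector [u0] will be the corner of the grid of mirror normals. With the sign of [b] in
    [a + b] or [a - b] chosen by that of [cos alpha], both products with [u0] have absolute value
    [1 + |cos alpha|]. *)
Lemma unit_pair_and_mirror (R : realType) (d : nat) (alpha : R) : (0 < d)%N ->
  exists a b u0 : 'rV[R]_d.+1,
    [/\ edot a a = 1, edot b b = 1 & edot a b = cos alpha] /\
    [/\ 1 <= u0 0 ord0, forall j, `|u0 0 j| <= 2,
        1 <= `|edot a u0| & 1 <= `|edot b u0|].
Proof.
move=> d0; have edot_delta i (v : 'rV[R]_d.+1) : edot (delta_mx 0 i) v = v 0 i.
  rewrite /edot (bigD1 i)//= mxE !eqxx mul1r big1 ?addr0// => j ji.
  by rewrite mxE eqxx (negbTE ji) mul0r.
pose a : 'rV[R]_d.+1 := delta_mx 0 ord0.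
pose b : 'rV[R]_d.+1 := cos alpha *: a + sin alpha *: delta_mx 0 ord_max.
have d0' : (ord0 == ord_max :> 'I_d.+1) = false by apply/eqP => /(congr1 val)/=; lia.
have a1 : edot a a = 1 by rewrite edot_delta mxE !eqxx.
have ab : edot a b = cos alpha.
  by rewrite edot_delta !mxE !eqxx d0' mulr1 mulr0 addr0.
have b1 : edot b b = 1.
  rewrite {2}/b edotDr !edotZr (edotC b a) ab (edotC b) edot_delta !mxE !eqxx eq_sym d0'.
  by rewrite mulr0 add0r mulr1 -!expr2 cos2Dsin2.
have unit_coord (c : 'rV[R]_d.+1) j : edot c c = 1 -> `|c 0 j| <= 1.
  move=> c1; apply: le_trans (rV_coord_le_norm c j) (le_trans (norm_le_enorm c) _).
  by rewrite /enorm c1 sqrtr1.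
have ba : edot b a = cos alpha by rewrite edotC.
have b0 : b 0 ord0 = cos alpha by rewrite -ab edot_delta.
have a0 : a 0 ord0 = 1 by rewrite mxE !eqxx.
have [c0|c0] := leP 0 (cos alpha).
- exists a, b, (a + b); split=> //; split.
  + by rewrite mxE a0 b0 lerDl.
  + move=> j; rewrite mxE; apply: le_trans (ler_normD _ _) _.
    by have := unit_coord a j a1; have := unit_coord b j b1; lra.
  + by rewrite edotDr a1 ab ger0_norm ?addr_ge0// lerDl.
  + by rewrite edotDr b1 ba ger0_norm ?addr_ge0// lerDr.
- exists a, b, (a - b); split=> //; split.
  + by rewrite !mxE; move: a0 b0; rewrite !mxE => -> ->; lra.
  + move=> j; rewrite !mxE; apply: le_trans (ler_normB _ _) _.
    by have := unit_coord a j a1; have := unit_coord b j b1; rewrite !mxE; lra.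
  + by rewrite edotDr edotNr a1 ab; apply: le_trans (ler_norm _); lra.
  + by rewrite edotDr edotNr b1 ba -normrN; apply: le_trans (ler_norm _); lra.
Qed.

Definition unseen (R : realType) (n : nat) (X : finType) (f : X -> 'rV[R]_n)
    (r e : R) (th : 'rV[R]_n) (i : X) : bool :=
  ~~ [exists j, (r <= `|f j - f i|) &&
       `[< exists2 t : R, 0 < t & `|f j - f i - t *: th| <= e >]].

Lemma unseenPn (R : realType) (n : nat) (X : finType) (f : X -> 'rV[R]_n)
    (r e : R) (th : 'rV[R]_n) (i : X) :
  reflect (exists j t, [/\ r <= `|f j - f i|, 0 < t &
                           `|f j - f i - t *: th| <= e])
          (~~ unseen f r e th i).
Proof.
rewrite negbK; apply: (iffP existsP) => -[j].
  by move=> /andP[rj /asboolP[t t0 tj]]; exists j, t.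
by move=> [t [rj t0 tj]]; exists j; rewrite rj/=; apply/asboolP; exists t.
Qed.

(** For points farther apart than [r], the sign of [t] tells which one sees the other; [e < r] rules
    out [t = 0]. *)
Lemma unseen_same_tube (R : realType) (n : nat) (X : finType)
    (f : X -> 'rV[R]_n) (r e : R) (th : 'rV[R]_n) (i j : X) :
  e < r -> unseen f r e th i -> unseen f r e th j ->
  in_tube e th (f i - f j) -> `|f i - f j| <= r.
Proof.
move=> er ui uj /asboolP[t tE]; rewrite leNgt; apply/negP => /ltW rij.
have [t0|t0|t0] := ltgtP t 0.
- move: ui; apply/negP/unseenPn; exists j, (- t); rewrite distrC oppr_gt0; split=> //.
  by rewrite scaleNr opprK -normrN opprD opprB.
- by move: uj; apply/negP/unseenPn; exists i, t.
- by move: tE; rewrite t0 scale0r subr0 leNgt (lt_le_trans er).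
Qed.

(** For each [g], Cauchy-Schwarz over the tubes of direction [th g] leaves only pairs at distance at
    most [2 ^- p]. After exchanging sums, a pair is weighted by the number of [g] whose tube
    contains its difference, which behaves like the kernel of the [d]-energy. *)
Lemma unseen_energy (R : realType) (d p m M : nat) (X : finType)
    (f : X -> 'rV[R]_d.+1) (mu : X -> R) (q : R) (c u0 : 'rV[R]_d.+1) :
  (p < m)%N -> 0 < q -> q * 2 ^+ d < 1 ->
  (forall i, 0 <= mu i) -> (forall i, `|f i| <= M%:R) ->
  (forall k i, (k <= m)%N -> \sum_(j | cell k (f i) (f j)) mu j <= q ^+ k) ->
  1 <= u0 0 ord0 -> (forall j, `|u0 0 j| <= 2) ->
  edot c c = 1 -> 1 <= `|edot c u0| ->
  (1 - q * 2 ^+ d) * \sum_(g : {ffun 'I_d.+1 -> 'I_(2 ^ m)})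
     (\sum_(i | unseen f (2 ^- p) (2 ^- m) (reflection (grid_pt u0 g) c) i) mu i) ^+ 2
  <= ((4 * M * 2 ^ m).+1 ^ d)%:R * (\sum_i mu i) *
     ((2 ^ m * tube_const d)%:R * 2 ^+ d * (3 ^ d.+1)%:R
      * (q * 2 ^+ d) ^+ p).
Proof.
move=> pm q0 rho1 mu0 fM muq u01 u02 c1 cu.
set K := (2 ^ m * _)%N; set rho := q * 2 ^+ d.
pose th (g : {ffun 'I_d.+1 -> 'I_(2 ^ m)}) := reflection (grid_pt u0 g) c.
have mp : 2 ^- m < 2 ^- p :> R.
  by rewrite ltf_pV2 ?posrE ?exprn_gt0// ltr_eXn2l// ltr1n.
have th0 g : th g != 0.
  rewrite -edot_eq0 edot_reflection ?c1 ?oner_eq0//; exact: grid_pt_neq0.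
pose tb g i j := in_tube (2 ^- m) (th g) (f i - f j).
pose cnt i j : R := #|[set g | tb g i j]|%:R.
have cntE i j : cnt i j = \sum_g (tb g i j)%:R.
  rewrite /cnt -sum1_card natr_sum [RHS]big_mkcond/= [LHS]big_mkcond/=.
  by apply: eq_bigr => g _; rewrite inE; case: (tb g i j).
have one_g g : (\sum_(i | unseen f (2 ^- p) (2 ^- m) (th g) i) mu i) ^+ 2 <=
    ((4 * M * 2 ^ m).+1 ^ d)%:R *
    \sum_i \sum_(j | `|f i - f j| <= 2 ^- p) mu i * (mu j * (tb g i j)%:R).
  have [b bP] := direction_buckets m M (th0 g).
  apply: le_trans (bucket_cauchy_schwarz _ (fun i => b (f i)) _) _.
  rewrite card_ffun !card_ord ler_wpM2l// big_mkcond/=; apply: ler_sum => i _.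
  case: ifP => [ui|_]; last first.
    by apply: sumr_ge0 => j _; rewrite !mulr_ge0.
  rewrite big_mkcond [leRHS]big_mkcond/=; apply: ler_sum => j _.
  case: ifP => [/andP[uj /eqP bij]|_]; last first.
    by case: ifP => // _; rewrite !mulr_ge0.
  have tij : tb g i j by apply: bP.
  by rewrite (unseen_same_tube mp ui uj tij) tij mulr1.
have rho1' : 0 <= 1 - rho by rewrite subr_ge0 ltW.
apply: (@le_trans _ _ ((1 - rho) * (((4 * M * 2 ^ m).+1 ^ d)%:R *
    \sum_i mu i * \sum_(j | `|f i - f j| <= 2 ^- p) mu j * cnt i j))).
  rewrite ler_wpM2l//; apply: le_trans (ler_sum _ (fun g _ => one_g g)) _.
  rewrite -mulr_sumr ler_wpM2l// exchange_big/=; apply: ler_sum => i _.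
  rewrite exchange_big/= mulr_sumr; apply: ler_sum => j _.
  by rewrite -mulr_sumr -mulr_sumr cntE.
rewrite mulrCA -mulrA ler_wpM2l// mulr_sumr mulr_suml; apply: ler_sum => i _.
rewrite mulrCA ler_wpM2l//; apply: (energy_le (m := m)) => //; first exact: ltnW.
- move=> j; rewrite /cnt -natrX -natrM ler_nat; apply: leq_trans (max_card _) _.
  rewrite card_ffun !card_ord expnS /K -mulnA leq_mul2l; apply/orP; right.
  rewrite -expnM mulnC; apply: leq_trans (leq_pmull _ _); last first.
    by rewrite /tube_const muln_gt0/= expn_gt0 muln_gt0 expn_gt0.
  by rewrite leq_exp2l// leq_mul2l leqnSn orbT.
- move=> k j km kij; rewrite /cnt -natrX -natrM ler_nat.
  exact: card_grid_tube.
Qed.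

Lemma sqrrD_le (R : realFieldType) (x y : R) :
  (x + y) ^+ 2 <= 2 * (x ^+ 2 + y ^+ 2).
Proof. by have := sqr_ge0 (x - y); rewrite sqrrB sqrrD; lra. Qed.

Lemma dyadic_cover (R : realType) (d : nat) (A : set 'rV[R]_d.+1)
    (alpha q eps : R) :
  (0 < d)%N -> compact A -> 0 < alpha <= pi -> ~ contains_angle A alpha ->
  0 < q -> q * 2 ^+ d < 1 -> 0 < eps ->
  exists s : seq ('rV[R]_d.+1 * nat),
    (forall x, A x -> exists2 c, c \in s & cell c.2 c.1 x) /\
    \sum_(c <- s) q ^+ c.2 < eps.
Proof.
move=> d0 cA ha noA q0 rho1 eps0.
have [M AM] := compact_nat_bound cA.
have [a [b [u0 [[a1 b1 ab] [u01 u02 au bu]]]]] := unit_pair_and_mirror alpha d0.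
set rho := q * 2 ^+ d in rho1.
have rho0 : 0 <= rho by rewrite mulr_ge0 ?exprn_ge0 ?ltW.
pose K := tube_const d.
(* One factor 2 comes from [sqrrD_le], the other from the two directions [a] and [b]. [C0] does not
   depend on [m], so [p] can be fixed first, then [eta] for [r = 2 ^- p], then [m]. *)
pose C0 : R := 4 * ((4 * M).+1 ^ d)%:R * (K%:R * 2 ^+ d * (3 ^ d.+1)%:R).
have [p pE] : exists p, C0 * rho ^+ p < (1 - rho) * eps.
  by apply: small_geometric => //; rewrite mulr_gt0// subr_gt0.
have p0 : 0 < 2 ^- p :> R by rewrite invr_gt0 exprn_gt0.
have [eta eta0 gap] := ray_gap cA ha noA p0.
have [m' m'E] : exists m' : nat, 1 * (2^-1) ^+ m' < eta.
  by apply: small_geometric => //; lra.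
pose m := (m' + p.+1)%N.
have pm : (p < m)%N by rewrite /m leq_addl.
have meta : 2 ^- m <= eta.
  apply: ltW; apply: le_lt_trans m'E; rewrite mul1r exprVn.
  by rewrite lef_pV2 ?posrE ?exprn_gt0// ler_eXn2l ?ltr1n// leq_addr.
have [X [f [fA net]]] := finite_net m AM.
have [mu [s [mu0 muq sX sE]]] := @weights_and_cover R X
  (fun k i j => cell k (f i) (f j)) q m q0
  (fun k i j l => cell_equiv k (f i) (f j) (f l))
  (fun k i j => @cell_nested _ _ k (f i) (f j)).
exists [seq (f c.1, c.2) | c <- s]; split.
  move=> x Ax; have [i ix] := net x Ax; have [c cs /andP[cm ci]] := sX i.
  exists (f c.1, c.2); first by apply/mapP; exists c.
  have [_ /(_ ci) /= ->] := cell_equiv c.2 (f c.1) (f i) x.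
  move: ix; rewrite -(subnK cm); elim: (m - c.2)%N => // l IH; rewrite addSn.
  by move/cell_nested.
rewrite big_map /= sE; set W := \sum_i mu i.
have W0 : 0 <= W by apply: sumr_ge0.
pose B c (g : {ffun 'I_d.+1 -> 'I_(2 ^ m)}) :=
  \sum_(i | unseen f (2 ^- p) (2 ^- m) (reflection (grid_pt u0 g) c) i) mu i.
have fM i : `|f i| <= M%:R by apply: AM.
have Ea := unseen_energy pm q0 rho1 mu0 fM muq u01 u02 a1 au.
have Eb := unseen_energy pm q0 rho1 mu0 fM muq u01 u02 b1 bu.
rewrite -/W -/rho -/K in Ea Eb.
(* A net point that sees far points in both reflected directions would contradict [gap], since
   reflections preserve the products of [a] and [b]. *)
have WB (g : {ffun 'I_d.+1 -> 'I_(2 ^ m)}) : W <= B a g + B b g.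
  rewrite /W /B [X in _ <= X + _]big_mkcond [X in _ <= _ + X]big_mkcond/= -big_split/=.
  apply: ler_sum => i _.
  have [ua|/unseenPn[j [t [rj t0 tj]]]] := boolP (unseen _ _ _ (reflection _ a) i).
    by rewrite lerDl; case: ifP.
  have [ub|/unseenPn[k [t' [rk t'0 tk]]]] := boolP (unseen _ _ _ (reflection _ b) i).
    by rewrite add0r.
  have g0 := grid_pt_neq0 u01 g; exfalso.
  apply: (gap (f i) (f j) (f k) _ _ t t' (fA i) (fA j) (fA k) _ _ _ t0 t'0 rj rk
    (le_trans tj meta) (le_trans tk meta)); by rewrite edot_reflection.
have WB2 (g : {ffun 'I_d.+1 -> 'I_(2 ^ m)}) : W ^+ 2 <= 2 * (B a g ^+ 2 + B b g ^+ 2).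
  apply: (@le_trans _ _ ((B a g + B b g) ^+ 2)).
    by rewrite ler_pXn2r// ?nnegrE// ?(le_trans W0 (WB g)).
  exact: sqrrD_le.
have sumW : ((2 ^ m) ^ d.+1)%:R * W ^+ 2 <=
    2 * (\sum_g B a g ^+ 2 + \sum_g B b g ^+ 2).
  have -> : ((2 ^ m) ^ d.+1)%:R * W ^+ 2 =
      \sum_(g : {ffun 'I_d.+1 -> 'I_(2 ^ m)}) W ^+ 2.
    by rewrite sumr_const card_ffun !card_ord mulr_natl.
  by rewrite -big_split mulr_sumr; apply: ler_sum => g _; apply: WB2.
(* The number of buckets is of order [2 ^ (m * d)]. With the [2 ^ m] from the tube count it cancels
   the grid size [(2 ^ m) ^ d.+1]. *)
have Nb : ((4 * M * 2 ^ m).+1 ^ d <= (4 * M).+1 ^ d * (2 ^ m) ^ d)%N.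
  rewrite -expnMn; apply: leq_exp2r_homo; rewrite mulSn -add1n leq_add2r.
  by rewrite expn_gt0.
have [W00|Wn0] := eqVneq W 0; first by rewrite W00.
have Wp : 0 < W by rewrite lt_def Wn0.
suff h : (1 - rho) * W <= C0 * rho ^+ p.
  have r1 : 0 < 1 - rho by rewrite subr_gt0.
  by rewrite -(ltr_pM2l r1); apply: le_lt_trans h pE.
have N0 : 0 < ((2 ^ m) ^ d.+1)%:R :> R by rewrite ltr0n !expn_gt0.
rewrite -(ler_pM2r Wp) -(ler_pM2l N0).
rewrite (_ : forall x y z : R, x * (y * z * z) = y * (x * z ^+ 2)); last first.
  by clear; move=> *; ring.
apply: (@le_trans _ _ ((1 - rho) * (2 * (\sum_g B a g ^+ 2 + \sum_g B b g ^+ 2)))).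
  by rewrite ler_wpM2l// subr_ge0 ltW.
set Z := (K%:R * 2 ^+ d * (3 ^ d.+1)%:R * rho ^+ p : R).
have Z0 : 0 <= Z by rewrite !mulr_ge0// exprn_ge0.
set U := (2 ^ m)%:R * Z * W * ((4 * M).+1 ^ d * (2 ^ m) ^ d)%:R.
have UE : ((4 * M * 2 ^ m).+1 ^ d)%:R * W *
    ((2 ^ m * K)%:R * 2 ^+ d * (3 ^ d.+1)%:R * rho ^+ p) <= U.
  have -> : ((4 * M * 2 ^ m).+1 ^ d)%:R * W *
      ((2 ^ m * K)%:R * 2 ^+ d * (3 ^ d.+1)%:R * rho ^+ p)
     = (2 ^ m)%:R * Z * W * ((4 * M * 2 ^ m).+1 ^ d)%:R.
    rewrite /Z natrM; move: (K%:R : R) ((3 ^ d.+1)%:R : R) ((2 ^ m)%:R : R).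
    by move=> k1 k2 k3; move: (((4 * M * 2 ^ m).+1 ^ d)%:R : R) => k4; ring.
  by rewrite ler_wpM2l ?ler_nat//; apply: mulr_ge0 => //; apply: mulr_ge0.
have {}Ea := le_trans Ea UE; have {}Eb := le_trans Eb UE.
rewrite -/(B a _) -/(B b _) in Ea Eb.
apply: (@le_trans _ _ (2 * (U + U))).
  clear -Ea Eb; rewrite mulrCA mulrDr; apply: ler_wpM2l; first exact: ler0n.
  by apply: lerD; [apply: Ea | apply: Eb].
rewrite /U /C0 /Z (expnS (2 ^ m)) (natrM _ (2 ^ m)) (natrM _ (_ ^ d)).
move: (K%:R : R) ((3 ^ d.+1)%:R : R) ((2 ^ m)%:R : R) => k1 k2 k3.
move: (((2 ^ m) ^ d)%:R : R) (((4 * M).+1 ^ d)%:R : R) => k4 k5.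
by clear; rewrite le_eqVlt; apply/orP; left; apply/eqP; ring.
Qed.

(** * Hausdorff measure *)

Lemma powR_dyadic (R : realType) (s : R) (k : nat) :
  (2 ^- k) `^ s = (2 `^ (- s)) ^+ k.
Proof.
rewrite -powR_mulrn ?powR_ge0// -powRrM mulNr mulrC -mulNr powRrM powRN.
by rewrite powR_mulrn.
Qed.

Lemma ediam_cell (R : realType) (n k : nat) (c : 'rV[R]_n) :
  (ediam [set x | cell k c x]%classic <= (n.+1%:R * 2 ^- k)%:E)%E.
Proof.
have k0 : 0 <= 2 ^- k :> R by rewrite invr_ge0 exprn_ge0.
rewrite /ediam ge_max lee_fin mulr_ge0//=.
apply: ge_ereal_sup => _ [[x y] [/= cx cy] <-]; rewrite lee_fin.
apply: le_trans (enorm_le_norm _) _; apply: ler_pM => //.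
  by rewrite ler_nat.
by apply: cell_dist; have [_ /(_ cx) <-] := cell_equiv k c x y.
Qed.

Lemma ediam_pow_ge0 (R : realType) (n : nat) (s : R) (U : set 'rV[R]_n) :
  (0 <= ediam_pow s U)%E.
Proof. by rewrite /ediam_pow; case: ifP => // _; apply: poweR_ge0. Qed.

(** A small sum makes each of its terms small, and since [0 < s] this bounds every cell's diameter:
    the condition on [delta] comes for free. *)
Lemma hausdorff_measure_eq0 (R : realType) (n : nat) (A : set 'rV[R]_n) (s : R) :
  0 < s ->
  (forall eps, 0 < eps -> exists l : seq ('rV[R]_n * nat),
    (forall x, A x -> exists2 c, c \in l & cell c.2 c.1 x) /\
    \sum_(c <- l) (2 `^ (- s)) ^+ c.2 < eps) ->
  hausdorff_measure s A = 0%E.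
Proof.
move=> s0 covers; set q := 2 `^ (- s) in covers.
have q0 k : 0 <= q ^+ k by rewrite exprn_ge0// powR_ge0.
apply/eqP; rewrite eq_le; apply/andP; split; last first.
  apply: (@le_trans _ _ (hausdorff_premeasure s 1 A)); last first.
    by apply: ereal_sup_ubound; exists 1 => //=.
  apply: le_ereal_inf_tmp => _ [U _ <-]; apply: nneseries_ge0 => i _ _.
  exact: ediam_pow_ge0.
apply: ge_ereal_sup => _ [delta /= delta0 <-]; apply/lee_addgt0Pr => e e0.
rewrite add0e; set N : R := n.+1%:R.
have N0 : 0 < N by rewrite ltr0n.
have Ns0 : 0 < N `^ s by rewrite powR_gt0.
(* The first bound controls the sum of the powers of diameters, the second each diameter. *)
have [|l [lA lE]] := covers (Num.min (e / N `^ s) ((delta / N) `^ s)).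
  by rewrite lt_min divr_gt0//= powR_gt0// divr_gt0.
move: lE; rewrite lt_min => /andP[le1 le2].
pose U i := if (i < size l)%N then
  [set x | cell (nth (0, 0%N) l i).2 (nth (0, 0%N) l i).1 x]%classic else set0.
apply: (@le_trans _ _ (\sum_(0 <= i <oo) ediam_pow s (U i))%E).
  apply: ereal_inf_lbound; exists U => //; split.
    move=> x /lA[c cl cx]; exists (index c l) => //.
    by rewrite /U index_mem cl nth_index.
  move=> i; rewrite /U; case: ltnP => il; last first.
    rewrite /ediam ge_max lee_fin (ltW delta0)/=.
    by apply: ge_ereal_sup => t [xy [xy0 _] _]; case: xy0.
  apply: le_trans (ediam_cell _ _) _; rewrite lee_fin mulrC -ler_pdivlMr//.
  set k := _.2; rewrite leNgt; apply/negP => dk.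
  suff : q ^+ k < (delta / N) `^ s.
    rewrite ltNge => /negP; apply; rewrite -powR_dyadic ltW// gt0_ltr_powR//.
      by rewrite nnegrE divr_ge0// ltW.
    by rewrite nnegrE invr_ge0 exprn_ge0.
  apply: le_lt_trans le2; rewrite (big_nth (0, 0%N)) (bigD1_seq i)/= ?iota_uniq//.
    by rewrite lerDl sumr_ge0.
  by rewrite mem_index_iota.
rewrite (nneseries_split _ (size l)); last by move=> i _; apply: ediam_pow_ge0.
rewrite add0n eseries0 ?adde0; last first.
  by move=> i li _; rewrite /U ltnNge li /= /ediam_pow eqxx.
apply: (@le_trans _ _ (\sum_(0 <= i < size l)
    (N `^ s * q ^+ (nth (0%R, 0%N) l i).2)%:E)%E).
  rewrite !big_nat; apply: lee_sum => i /andP[_ il]; rewrite /U il /ediam_pow.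
  case: ifP => _; first by rewrite lee_fin mulr_ge0// powR_ge0.
  set k := _.2; have -> : N `^ s * q ^+ k = (N * 2 ^- k) `^ s.
    by rewrite powRM ?powR_dyadic// ?ltW// invr_ge0 exprn_ge0.
  rewrite -poweR_EFin; apply: gt0_ler_poweR; first exact: ltW.
  - by rewrite in_itv/= leey andbT le_max lexx.
  - by rewrite in_itv/= leey andbT lee_fin mulr_ge0 ?invr_ge0 ?exprn_ge0// ltW.
  - exact: ediam_cell.
rewrite sumEFin lee_fin -mulr_sumr mulrC -ler_pdivlMr// ltW//.
by move: le1; rewrite (big_nth (0, 0%N)).
Qed.

Theorem theorem2p2 (R : realType) (n : nat) (alpha : R)
    (hn : (2 <= n)%N) (halpha : 0 <= alpha <= pi) :
  (C n alpha <= (n%:R - 1)%:E)%E.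
Proof.
case: n hn => // d d1; rewrite -natr1 addrK.
apply: ge_ereal_sup => _ [A [cA <- noA]].
(* The gap argument needs a positive angle, so 0 is traded for [pi]. *)
have [beta hbeta noB] : exists2 beta : R, 0 < beta <= pi & ~ contains_angle A beta.
  have [a0|a0] := eqVneq alpha 0.
    exists pi; first by rewrite pi_gt0 lexx.
    by move=> /contains_angle_pi0; rewrite -a0.
  by exists alpha => //; rewrite lt_def a0.
apply/lee_addgt0Pr => e e0; apply: ereal_inf_lbound.
have s0 : 0 < d%:R + e by rewrite ltr_wpDl.
exists (d%:R + e) => //=; split; first exact: ltW.
apply: hausdorff_measure_eq0 => // eps eps0.
apply: (dyadic_cover _ cA hbeta noB) => //.
(* Here [q = 2 ^ (- (d + e))], so the ratio [q * 2 ^ d] is [2 ^ (- e)], below 1. *)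
rewrite -powR_mulrn// -powRD; last by rewrite pnatr_eq0 implybT.
rewrite opprD addrAC addNr add0r powRN invf_lt1 ?powR_gt0//.
have : 1 `^ e < 2 `^ e :> R by rewrite gt0_ltr_powR ?nnegrE ?ltr1n.
by rewrite powR1.
Qed.
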